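(* Let $\Omega\subset\mathbb{R}^n$ be a bounded domain and let $p\in C^1(\Omega)\cap W^{1,\infty}(\Omega)$ with $p(x)>1$ for all $x\in\Omega$. Let $u$ be a nonnegative viscosity solution in $\Omega$ of $$\Delta_{\infty(x)}u=\sum_{i,j=1}^{n}u_{x_i}u_{x_j}u_{x_ix_j}+|\nabla u|^2\ln|\nabla u|\,\langle\nabla u,\nabla\ln p\rangle=0 .$$ Then for all concentric balls $B_R\subset B_{2R}$ of radii $R$ and $2R$ with $B_{2R}\subset\Omega$ and $\sup_{B_{2R}}u<\infty$, the inequality $$\sup_{x\in B_R}u(x)\le C\left(\inf_{x\in B_R}u(x)+R\right)$$ holds, where, for the given $\Omega$ and $p$, the constant $C$ depends on $u$ and on the ball only through $\sup_{B_{2R}}u$.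
   Context: For $\varphi\in C^2(\Omega)$ and $x_0\in\Omega$ write $$\Delta_{\infty(x_0)}\varphi(x_0)=\sum_{i,j=1}^n\varphi_{x_i}(x_0)\varphi_{x_j}(x_0)\varphi_{x_ix_j}(x_0)+|\nabla\varphi(x_0)|^2\ln|\nabla\varphi(x_0)|\,\langle\nabla\varphi(x_0),\nabla\ln p(x_0)\rangle,$$ where $|\xi|^2\ln|\xi|$ is read as $0$ for $\xi=0$. A lower semicontinuous function $v:\Omega\to(-\infty,\infty]$ is a viscosity supersolution if, whenever $x_0\in\Omega$ and $\varphi\in C^2(\Omega)$ satisfy $\varphi(x_0)=v(x_0)$ and $\varphi(x)<v(x)$ for $x\neq x_0$, we have $\Delta_{\infty(x_0)}\varphi(x_0)\le 0$. An upper semicontinuous function $u:\Omega\to[-\infty,\infty)$ is a viscosity subsolution if, whenever $x_0\in\Omega$ and $\varphi\in C^2(\Omega)$ satisfy $\varphi(x_0)=u(x_0)$ and $\varphi(x)>u(x)$ for $x\ne x_0$, we have $\Delta_{\infty(x_0)}\varphi(x_0)\ge 0$. A viscosity solution is a function that is both a viscosity supersolution and a viscosity subsolution. *)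

(* Defs.v *)
From HB Require Import structures.
From mathcomp Require Import all_boot all_order all_algebra.
From mathcomp Require Import all_classical all_reals all_analysis.

Set Implicit Arguments.
Unset Strict Implicit.
Unset Printing Implicit Defensive.

Import Order.TTheory GRing.Theory Num.Theory.
Import numFieldNormedType.Exports.

Local Open Scope classical_set_scope.
Local Open Scope ring_scope.

(* The library norm on row vectors is the sup norm, so the Euclidean structure
   is introduced here. *)
Definition dotp (R : realType) (n : nat) (v w : 'rV[R]_n) : R :=
  \sum_(i < n) v 0 i * w 0 i.

Definition enorm (R : realType) (n : nat) (v : 'rV[R]_n) : R :=
  Num.sqrt (dotp v v).

Definition eball (R : realType) (n : nat) (x : 'rV[R]_n) (r : R) :
  set 'rV[R]_n := [set y | enorm (y - x) < r].

Definition domain (R : realType) (n : nat) (Omega : set 'rV[R]_n) : Prop :=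
  [/\ open Omega, connected Omega & Omega !=set0].

Definition partial (R : realType) (n : nat) (i : 'I_n) (f : 'rV[R]_n -> R)
  (x : 'rV[R]_n) : R := 'D_(delta_mx 0 i) f x.

Definition grad (R : realType) (n : nat) (f : 'rV[R]_n -> R) (x : 'rV[R]_n) :
  'rV[R]_n := \row_(i < n) partial i f x.

(* C^k(Omega) for Omega open. Functions are total, but for x in Omega both
   continuity at x and the partial derivatives at x only depend on the values
   on Omega. *)
Fixpoint Ck (R : realType) (n k : nat) (Omega : set 'rV[R]_n)
    (f : 'rV[R]_n -> R) {struct k} : Prop :=
  (forall x, Omega x -> {for x, continuous f}) /\
  match k with
  | 0 => True
  | k'.+1 => forall i : 'I_n,
      (forall x, Omega x -> derivable f x (delta_mx 0 i)) /\
      Ck k' Omega (partial i f)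
  end.

Definition borelRn (R : realType) (n : nat) :=
  g_sigma_algebraType (@open 'rV[R]_n).

(* n-dimensional Lebesgue measure on the Borel sets is the unique measure that
   gives every box its volume. *)
Definition is_lebesgue (R : realType) (n : nat)
    (mu : {measure set (borelRn R n) -> \bar R}) : Prop :=
  forall a b : 'rV[R]_n, (forall i, a 0 i <= b 0 i) ->
    mu [set x : 'rV[R]_n | forall i, a 0 i <= x 0 i < b 0 i] =
    (\prod_(i < n) (b 0 i - a 0 i))%:E.

(* Borel rather than Lebesgue measurability loses nothing: every class of
   L^oo(Omega) has a Borel representative. *)
Definition Linfty (R : realType) (n : nat)
    (mu : {measure set (borelRn R n) -> \bar R}) (Omega : set 'rV[R]_n)
    (f : 'rV[R]_n -> R) : Prop :=
  measurable_fun (Omega : set (borelRn R n)) (f : borelRn R n -> R) /\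
  exists M : R, {ae mu, forall x : borelRn R n, Omega x -> `|f x| <= M}.

(* Weak derivatives are tested against C^1_c(Omega), as in Gilbarg-Trudinger
   (7.15); by mollification C^oo_c(Omega) gives the same notion. *)
Definition C1c (R : realType) (n : nat) (Omega : set 'rV[R]_n)
    (phi : 'rV[R]_n -> R) : Prop :=
  Ck 1 Omega phi /\
  exists K : set 'rV[R]_n, [/\ compact K, K `<=` Omega &
    forall x, Omega x -> ~ K x -> phi x = 0].

Definition weak_partial (R : realType) (n : nat)
    (mu : {measure set (borelRn R n) -> \bar R}) (Omega : set 'rV[R]_n)
    (i : 'I_n) (f g : 'rV[R]_n -> R) : Prop :=
  forall phi, C1c Omega phi ->
    (\int[mu]_(x in Omega) (f x * partial i phi x)%:E =
     - \int[mu]_(x in Omega) (g x * phi x)%:E)%E.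

Definition W1infty (R : realType) (n : nat) (Omega : set 'rV[R]_n)
    (f : 'rV[R]_n -> R) : Prop :=
  exists mu : {measure set (borelRn R n) -> \bar R},
    [/\ is_lebesgue mu, Linfty mu Omega f &
        forall i : 'I_n, exists2 g : 'rV[R]_n -> R,
          Linfty mu Omega g & weak_partial mu Omega i f g].

(* At a critical point of phi the logarithmic term is 0, because ln 0 = 0 in
   the library. *)
Definition infty_laplacian (R : realType) (n : nat) (p phi : 'rV[R]_n -> R)
    (x : 'rV[R]_n) : R :=
  (\sum_(i < n) \sum_(j < n)
     partial i phi x * partial j phi x * partial j (partial i phi) x) +
  enorm (grad phi x) ^+ 2 * ln (enorm (grad phi x)) *
    dotp (grad phi x) (grad (fun y => ln (p y)) x).

(* Semicontinuity is relative to Omega: points outside Omega are isolated in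
   [subspace Omega]. *)
Definition viscosity_supersolution (R : realType) (n : nat)
    (Omega : set 'rV[R]_n) (p : 'rV[R]_n -> R) (v : 'rV[R]_n -> \bar R) : Prop :=
  [/\ lower_semicontinuous (v : subspace Omega -> \bar R),
      forall x, Omega x -> (-oo < v x)%E &
      forall (x0 : 'rV[R]_n) (phi : 'rV[R]_n -> R),
        Omega x0 -> Ck 2 Omega phi ->
        (phi x0)%:E = v x0 ->
        (forall x, Omega x -> x != x0 -> ((phi x)%:E < v x)%E) ->
        infty_laplacian p phi x0 <= 0].

Definition viscosity_subsolution (R : realType) (n : nat)
    (Omega : set 'rV[R]_n) (p : 'rV[R]_n -> R) (u : 'rV[R]_n -> \bar R) : Prop :=
  [/\ lower_semicontinuous ((fun x => - u x)%E : subspace Omega -> \bar R),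
      forall x, Omega x -> (u x < +oo)%E &
      forall (x0 : 'rV[R]_n) (phi : 'rV[R]_n -> R),
        Omega x0 -> Ck 2 Omega phi ->
        (phi x0)%:E = u x0 ->
        (forall x, Omega x -> x != x0 -> (u x < (phi x)%:E)%E) ->
        0 <= infty_laplacian p phi x0].

Definition viscosity_solution (R : realType) (n : nat)
    (Omega : set 'rV[R]_n) (p : 'rV[R]_n -> R) (u : 'rV[R]_n -> \bar R) : Prop :=
  viscosity_supersolution Omega p u /\ viscosity_subsolution Omega p u.

(* Main.v *)
Require Import Defs.
From HB Require Import structures.
From mathcomp Require Import all_boot all_order all_algebra.
From mathcomp Require Import all_classical all_reals all_analysis.
From mathcomp Require Import measurable_realfun ring lra.

Set Implicit Arguments.
Unset Strict Implicit.
Unset Printing Implicit Defensive.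

Import Order.TTheory GRing.Theory Num.Theory.
Import numFieldNormedType.Exports.

Local Open Scope classical_set_scope.
Local Open Scope ring_scope.

(** The estimate rests on one family of barriers. For a supersolution u >= 0
    and a point y with u(y) = m consider
      w(x) = m (exp(- alpha |x - y|) - e) / (1 - e),  e = exp(- alpha rho),
    which equals m at y and vanishes on the sphere of radius rho. With
    k = |grad w|, the equation evaluated on w is
      k^3 alpha + k^2 ln k <grad w, grad ln p> >= k^3 (alpha - K |ln k|),
    where K bounds |grad ln p|. So w is a strict subsolution off its vertex as
    soon as alpha > K |ln k|. The slope k is comparable to m / rho up to a
    factor exp(alpha rho), so alpha = 1 + 2 K ln (m / rho) is large enough when
    K rho <= 1/4 and m >= rho ([barrier_slope]). By comparison u >= w
    ([cone_comparison]), which bounds u from below by a fraction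
    exp(- alpha rho) / 2 of m on the ball of radius rho / 2.

    The logarithm makes alpha grow as rho tends to 0, but alpha rho does not:
    rho ln (m / rho) <= m. Hence that fraction is controlled by the supremum of
    u, uniformly in rho, and the case m < rho is absorbed by the additive term
    of the inequality ([local_Harnack]). Taking rho a fixed fraction of R and
    chaining along segments gives the inequality on the ball of radius R
    ([Harnack_chain]); the number of steps depends only on K and on a bound for
    R, which the bounded set Omega provides.

    The comparison is carried out with the definition of viscosity
    supersolutions. The two semicontinuities of a viscosity solution make u
    continuous, so u - w attains its minimum. If that minimum is negative, the
    barrier touches u from below up to a constant, and it is replaced there by
    a function that is smooth on the whole space ([cone_touch],
    [supersolution_radial]).

    It remains to bound grad ln p, that is grad p since p > 1, at every point.
    The hypothesis bounds a weak gradient almost everywhere, and p is of class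
    C^1, so both gradients must be compared ([partial_le_of_weak]). The
    integration by parts needed for this reduces to the statement that partial
    derivatives of compactly supported functions have integral zero
    ([integral_partial_eq0]), which follows from the translation invariance of
    Lebesgue measure ([lebesgue_translation]), that is, from its values on
    boxes. *)

(** * Directional derivatives and radial functions *)

(** This lets the one-variable calculus be used for the partial derivatives:
    along a coordinate line a radial function is a function of a quadratic
    polynomial. *)
Lemma is_derive_line (R : realType) (V : normedModType R) (f : V -> R)
    (x v : V) (d : R) :
  is_derive x v f d <-> is_derive (0 : R) 1 (fun h : R => f (h *: v + x)) d.
Proof.
have E : 'D_v f x = 'D_1 (fun h : R => f (h *: v + x)) 0.
  rewrite /derive; set A := (X in lim (X @ _) = _); set B := (X in _ = lim (X @ _)).
  suff -> : A = B by [].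
  apply/funext => h; rewrite /A /B /=.
  by rewrite addr0 scale0r add0r -[(h *: 1)%R]/(h * 1) mulr1.
split=> -[df fd]; split.
- exact: (iffLR (derivable1P f x v) df).
- by rewrite -E.
- exact: (iffRL (derivable1P f x v) df).
- by rewrite E.
Qed.

Lemma is_derive_compR (R : realType) (V : normedModType R) (F : R -> R)
    (g : V -> R) (x v : V) (a b : R) :
  is_derive (g x) 1 F a -> is_derive x v g b ->
  is_derive x v (fun y => F (g y)) (a * b).
Proof.
move=> dF /is_derive_line dg; apply/is_derive_line.
apply: (@is_derive1_comp _ F (fun h : R => g (h *: v + x))) => //.
by rewrite scale0r add0r.
Qed.

Lemma is_derive_mulR (R : realType) (V : normedModType R) (f g : V -> R)
    (x v : V) (a b : R) :
  is_derive x v f a -> is_derive x v g b ->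
  is_derive x v (fun y => f y * g y) (a * g x + f x * b).
Proof.
move=> df dg; apply: (is_derive_eq (is_deriveM df dg)).
by rewrite /GRing.scale /= addrC (mulrC (g x)).
Qed.

Lemma is_derive_addR (R : realType) (V : normedModType R) (f g : V -> R)
    (x v : V) (a b : R) :
  is_derive x v f a -> is_derive x v g b ->
  is_derive x v (fun y => f y + g y) (a + b).
Proof. by move=> df dg; exact: is_deriveD. Qed.

Lemma partial_is_derive (R : realType) (n : nat) (i : 'I_n)
    (f : 'rV[R]_n -> R) (x : 'rV[R]_n) (d : R) :
  is_derive x (delta_mx 0 i) f d -> partial i f x = d.
Proof. by case. Qed.

Lemma continuous_mulR (R : realType) (T : topologicalType) (f g : T -> R) (x : T) :
  {for x, continuous f} -> {for x, continuous g} ->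
  {for x, continuous (fun y => f y * g y)}.
Proof. exact: continuousM. Qed.

Lemma continuous_addR (R : realType) (T : topologicalType) (f g : T -> R) (x : T) :
  {for x, continuous f} -> {for x, continuous g} ->
  {for x, continuous (fun y => f y + g y)}.
Proof. exact: continuousD. Qed.

Definition sqdist (R : realType) (n : nat) (y x : 'rV[R]_n) : R :=
  dotp (x - y) (x - y).

Lemma sqdistE (R : realType) (n : nat) (y x : 'rV[R]_n) :
  sqdist y x = \sum_(i < n) (x 0 i - y 0 i) ^+ 2.
Proof. by apply: eq_bigr => i _; rewrite !mxE expr2. Qed.

Lemma sqdist_ge0 (R : realType) (n : nat) (y x : 'rV[R]_n) : 0 <= sqdist y x.
Proof. by rewrite sqdistE; apply: sumr_ge0 => i _; exact: sqr_ge0. Qed.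

Lemma sqr_enorm (R : realType) (n : nat) (v : 'rV[R]_n) :
  enorm v ^+ 2 = dotp v v.
Proof. by rewrite sqr_sqrtr //; apply: sumr_ge0 => i _; rewrite -expr2 sqr_ge0. Qed.

Lemma sqr_coord_le_sqdist (R : realType) (n : nat) (i : 'I_n)
    (y x : 'rV[R]_n) : (x 0 i - y 0 i) ^+ 2 <= sqdist y x.
Proof.
rewrite sqdistE (bigD1 i) //= lerDl.
by apply: sumr_ge0 => j _; exact: sqr_ge0.
Qed.

Lemma sqdist_eq0 (R : realType) (n : nat) (y x : 'rV[R]_n) :
  (sqdist y x == 0) = (x == y).
Proof.
apply/idP/eqP => [/eqP h|->]; last first.
  by rewrite sqdistE big1// => i _; rewrite subrr expr0n.
apply/rowP => i; apply/eqP; rewrite -subr_eq0 -sqrf_eq0 eq_le sqr_ge0 andbT -h.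
exact: sqr_coord_le_sqdist.
Qed.

Lemma sqdist_line (R : realType) (n : nat) (y x : 'rV[R]_n) (i : 'I_n) (h : R) :
  sqdist y (h *: delta_mx 0 i + x) =
  sqdist y x + (2 * (x 0 i - y 0 i) * h + h ^+ 2).
Proof.
rewrite !sqdistE (bigD1 i) //= [in RHS](bigD1 i) //= !mxE !eqxx mulr1.
rewrite (eq_bigr (fun j => (x 0 j - y 0 j) ^+ 2)); first ring.
by move=> j ji; rewrite !mxE (negbTE ji) andbF mulr0 add0r.
Qed.

Lemma is_derive_sqdist (R : realType) (n : nat) (y x : 'rV[R]_n) (i : 'I_n) :
  is_derive x (delta_mx 0 i) (sqdist y) (2 * (x 0 i - y 0 i)).
Proof.
apply/is_derive_line.
under eq_fun do rewrite sqdist_line.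
apply: is_derive_eq.
rewrite /GRing.scale /=; ring.
Qed.

Lemma is_derive_coord (R : realType) (n : nat) (x c : 'rV[R]_n) (i j : 'I_n) :
  is_derive x (delta_mx 0 j) (fun y => y 0 i - c 0 i) (i == j)%:R.
Proof.
apply/is_derive_line.
under eq_fun do rewrite !mxE eqxx /=.
apply: is_derive_eq.
by rewrite /GRing.scale /= !mulr0 !mulr1 !addr0 add0r subr0.
Qed.

Lemma continuous_coordB (R : realType) (n : nat) (c : 'rV[R]_n) (i : 'I_n) :
  continuous (fun y : 'rV[R]_n => y 0 i - c 0 i).
Proof.
move=> x; apply: (@continuousB _ _ _ (fun y : 'rV[R]_n => y 0 i) (fun=> c 0 i)).
  exact: coord_continuous.
exact: cst_continuous.
Qed.

Lemma continuous_sqdist (R : realType) (n : nat) (y : 'rV[R]_n) :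
  continuous (sqdist y).
Proof.
rewrite (_ : sqdist y = fun x => \sum_(i < n) (x 0 i - y 0 i) ^+ 2); last first.
  by apply/funext => x; rewrite sqdistE.
move=> x; apply: (@cvg_big _ _ +%R 0 xpredT _ _ (nbhs x)) => [z|i _].
  exact: add_continuous.
by apply: cvgM; exact: continuous_coordB.
Qed.

Definition radial (R : realType) (n : nat) (y : 'rV[R]_n) (F : R -> R)
  (x : 'rV[R]_n) : R := F (sqdist y x).

Lemma is_derive_radial (R : realType) (n : nat) (y x : 'rV[R]_n) (i : 'I_n)
    (F : R -> R) (d : R) :
  is_derive (sqdist y x) 1 F d ->
  is_derive x (delta_mx 0 i) (radial y F) (d * (2 * (x 0 i - y 0 i))).
Proof. by move=> dF; exact: (is_derive_compR dF (is_derive_sqdist y x i)). Qed.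

Lemma is_derive_continuous (R : realType) (F dF : R -> R) :
  (forall t : R, is_derive t 1 F (dF t)) -> continuous F.
Proof.
move=> h t; apply: differentiable_continuous.
by apply/derivable1_diffP; case: (h t).
Qed.

Lemma continuous_radial (R : realType) (n : nat) (y : 'rV[R]_n) (F : R -> R) :
  continuous F -> continuous (radial y F).
Proof.
by move=> cF x; apply: (@continuous_comp _ _ _ (sqdist y) F);
  [exact: continuous_sqdist|exact: cF].
Qed.

Lemma Ck1_of_partials (R : realType) (n : nat) (Omega : set 'rV[R]_n)
    (f : 'rV[R]_n -> R) (D : 'I_n -> 'rV[R]_n -> R) :
  continuous f ->
  (forall i x, is_derive x (delta_mx 0 i) f (D i x)) ->
  (forall i, continuous (D i)) -> Ck 1 Omega f.
Proof.
move=> cf df cD; split; first by move=> x _; exact: cf.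
move=> i; split; first by move=> x _; case: (df i x).
split; last exact: I.
move=> x _; rewrite (_ : partial i f = D i); first exact: cD.
by apply/funext => z; exact: partial_is_derive.
Qed.

Lemma Ck2_of_partials (R : realType) (n : nat) (Omega : set 'rV[R]_n)
    (f : 'rV[R]_n -> R) (D : 'I_n -> 'rV[R]_n -> R)
    (H : 'I_n -> 'I_n -> 'rV[R]_n -> R) :
  continuous f ->
  (forall i x, is_derive x (delta_mx 0 i) f (D i x)) ->
  (forall i, continuous (D i)) ->
  (forall i j x, is_derive x (delta_mx 0 j) (D i) (H i j x)) ->
  (forall i j, continuous (H i j)) -> Ck 2 Omega f.
Proof.
move=> cf df cD dD cH; split; first by move=> x _; exact: cf.
move=> i; split; first by move=> x _; case: (df i x).
rewrite (_ : partial i f = D i); last first.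
  by apply/funext => z; exact: partial_is_derive.
exact: (@Ck1_of_partials _ _ _ _ (H i)).
Qed.

(** The test functions below are functions of the squared distance: unlike the
    distance itself, it is smooth at the centre, so that global smoothness of
    the profile F is all that is needed. *)
Section radial_derivatives.
Variables (R : realType) (n : nat) (y : 'rV[R]_n) (F dF ddF : R -> R).
Hypothesis dFE : forall t : R, is_derive t 1 F (dF t).
Hypothesis ddFE : forall t : R, is_derive t 1 dF (ddF t).

Definition radial_grad (i : 'I_n) (x : 'rV[R]_n) : R :=
  dF (sqdist y x) * (2 * (x 0 i - y 0 i)).

Definition radial_hess (i j : 'I_n) (x : 'rV[R]_n) : R :=
  4 * ddF (sqdist y x) * (x 0 i - y 0 i) * (x 0 j - y 0 j) +
  2 * dF (sqdist y x) * (i == j)%:R.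

Lemma is_derive_radial_grad (i j : 'I_n) (x : 'rV[R]_n) :
  is_derive x (delta_mx 0 j) (radial_grad i) (radial_hess i j x).
Proof.
have d2 : is_derive x (delta_mx 0 j) (fun z : 'rV[R]_n => 2 * (z 0 i - y 0 i))
    (0 * (x 0 i - y 0 i) + 2 * (i == j)%:R).
  have d0 : is_derive x (delta_mx 0 j) (cst (2 : R)) 0 by exact: is_derive_cst.
  exact: is_derive_mulR d0 (is_derive_coord x y i j).
apply: (is_derive_eq (is_derive_mulR (is_derive_radial _ (ddFE _)) d2)).
rewrite /radial /radial_hess; ring.
Qed.

Lemma continuous_radial_grad (i : 'I_n) :
  continuous dF -> continuous (radial_grad i).
Proof.
move=> c x.
apply: (@continuous_mulR _ _ (radial y dF) (fun z => 2 * (z 0 i - y 0 i)) x);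
  first exact: (continuous_radial c).
apply: continuous_mulR; [exact: cst_continuous|exact: continuous_coordB].
Qed.

Lemma continuous_radial_hess (i j : 'I_n) :
  continuous ddF -> continuous (radial_hess i j).
Proof.
move=> c x.
apply: (@continuous_addR _ _
  (fun z => 4 * ddF (sqdist y z) * (z 0 i - y 0 i) * (z 0 j - y 0 j))
  (fun z => 2 * dF (sqdist y z) * (i == j)%:R) x).
  apply: continuous_mulR; last exact: continuous_coordB.
  apply: continuous_mulR; last exact: continuous_coordB.
  apply: continuous_mulR; first exact: cst_continuous.
  exact: (continuous_radial c).
apply: continuous_mulR; last exact: cst_continuous.
apply: continuous_mulR; first exact: cst_continuous.
exact: (continuous_radial (is_derive_continuous ddFE)).
Qed.

End radial_derivatives.

(** * The Euclidean norm *)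

Section euclidean_norm.
Variables (R : realType) (n : nat).
Implicit Types (v w x y : 'rV[R]_n).

Lemma dotpC v w : dotp v w = dotp w v.
Proof. by apply: eq_bigr => i _; rewrite mulrC. Qed.

Lemma dotpDl v w x : dotp (v + w) x = dotp v x + dotp w x.
Proof. by rewrite -big_split /=; apply: eq_bigr => i _; rewrite mxE mulrDl. Qed.

Lemma dotpZl (a : R) v x : dotp (a *: v) x = a * dotp v x.
Proof. by rewrite /dotp mulr_sumr; apply: eq_bigr => i _; rewrite mxE mulrA. Qed.

Lemma dotp_ge0 v : 0 <= dotp v v.
Proof. by apply: sumr_ge0 => i _; rewrite -expr2 sqr_ge0. Qed.

Lemma enorm_ge0 v : 0 <= enorm v.
Proof. exact: sqrtr_ge0. Qed.

Lemma sqdist_enorm x y : sqdist y x = enorm (x - y) ^+ 2.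
Proof. by rewrite sqr_enorm. Qed.

Lemma enormZ (a : R) v : enorm (a *: v) = `|a| * enorm v.
Proof.
by rewrite /enorm dotpZl dotpC dotpZl mulrA -expr2 sqrtrM ?sqr_ge0// sqrtr_sqr.
Qed.

Lemma enorm_sub_sym x y : enorm (x - y) = enorm (y - x).
Proof. by rewrite -opprB -scaleN1r enormZ normrN normr1 mul1r. Qed.

Lemma enorm_sub_eq0 x y : (enorm (x - y) == 0) = (x == y).
Proof. by rewrite -sqdist_eq0 sqdist_enorm sqrf_eq0. Qed.

Lemma coord_le_enorm v (i : 'I_n) : `|v 0 i| <= enorm v.
Proof.
rewrite -(ler_pXn2r (n := 2)) ?nnegrE ?enorm_ge0// sqr_enorm real_normK ?num_real//.
by have := sqr_coord_le_sqdist i 0 v; rewrite /sqdist !mxE !subr0.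
Qed.

Lemma Cauchy_Schwarz v w : dotp v w <= enorm v * enorm w.
Proof.
have [w0|w0] := eqVneq (enorm w) 0.
  rewrite w0 mulr0 /dotp big1// => i _.
  have := coord_le_enorm w i; rewrite w0 normr_le0 => /eqP ->.
  by rewrite mulr0.
have ww : 0 < dotp w w by rewrite -sqr_enorm exprn_gt0// lt_def w0 enorm_ge0.
have := dotp_ge0 (dotp w w *: v + (- dotp v w) *: w).
rewrite !dotpDl !dotpZl ![dotp _ (_ + _)]dotpC !dotpDl !dotpZl (dotpC w v).
rewrite (_ : _ + _ = dotp w w * (dotp v v * dotp w w - dotp v w ^+ 2)); last ring.
rewrite pmulr_rge0// subr_ge0 -!sqr_enorm -exprMn => h.
apply: (le_trans (ler_norm _)).
rewrite -(ler_pXn2r (n := 2)) ?nnegrE ?mulr_ge0 ?enorm_ge0//.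
by rewrite real_normK ?num_real.
Qed.

Lemma enorm_triangle v w : enorm (v + w) <= enorm v + enorm w.
Proof.
rewrite -(ler_pXn2r (n := 2)) ?nnegrE ?addr_ge0 ?enorm_ge0// sqr_enorm.
rewrite dotpDl ![dotp _ (_ + _)]dotpC !dotpDl (dotpC w v) -!sqr_enorm sqrrD.
have := Cauchy_Schwarz v w; lra.
Qed.

Lemma enorm_sub_triangle x y z : enorm (x - z) <= enorm (x - y) + enorm (y - z).
Proof. by rewrite -(subrKA y); exact: enorm_triangle. Qed.

Lemma dotp_le_bounded v w (M : R) : (forall i, `|w 0 i| <= M) ->
  `|dotp v w| <= enorm v * (n%:R * M).
Proof.
move=> wM; rewrite /dotp (le_trans (ler_norm_sum _ _ _))//.
rewrite (le_trans (ler_sum _ (_ : forall i, true -> _ <= enorm v * M)))//.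
  by move=> i _; rewrite normrM ler_pM// coord_le_enorm.
by rewrite sumr_const card_ord -[X in X <= _]mulr_natl mulrCA.
Qed.

Lemma norm_le_enorm v : `|v| <= enorm v.
Proof.
rewrite /Num.norm /= mx_normrE; apply/bigmax_leP; split; first exact: enorm_ge0.
by move=> [i j] _ /=; rewrite ord1 coord_le_enorm.
Qed.

Lemma coord_le_norm v (i : 'I_n) : `|v 0 i| <= `|v|.
Proof.
by rewrite [leRHS]/Num.norm /= mx_normrE; apply/bigmax_geP; right => /=; exists (0, i).
Qed.

Lemma continuous_enorm_sub x : continuous (fun y => enorm (y - x)).
Proof.
move=> y; apply: (@continuous_comp _ _ _ (sqdist x) Num.sqrt).
  exact: continuous_sqdist.
exact: sqrt_continuous.
Qed.

Lemma compact_closed_eball x (r : R) :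
  compact [set y : 'rV[R]_n | enorm (y - x) <= r].
Proof.
apply: bounded_closed_compact.
  exists (`|x| + r); split; first exact: num_real.
  move=> M xM y /= yr; rewrite (le_trans _ (ltW xM))//.
  rewrite -(subrK x y) addrC (le_trans (ler_normD _ _))// lerD2l.
  exact: le_trans (norm_le_enorm _) yr.
rewrite (_ : [set _ | _] = (fun y => enorm (y - x)) @^-1` [set t | t <= r]) //.
apply: closed_comp; last exact: closed_le.
by move=> y _; exact: continuous_enorm_sub.
Qed.

End euclidean_norm.

(** * Touching a supersolution from below *)

Section touching.
Variables (R : realType) (n : nat) (Omega : set 'rV[R]_n) (p : 'rV[R]_n -> R).
Variables (v : 'rV[R]_n -> \bar R).
Hypothesis superv : viscosity_supersolution Omega p v.

(** Touching from below must be strict on all of Omega away from x. Subtracting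
    |z - x|^4 makes it strict, also along the sphere around y through x, and
    changes no derivative of order at most two at x. *)
Lemma supersolution_radial (y x : 'rV[R]_n) (F dF ddF : R -> R) :
  (forall t : R, is_derive t 1 F (dF t)) ->
  (forall t : R, is_derive t 1 dF (ddF t)) -> continuous ddF ->
  Omega x -> (F (sqdist y x))%:E = v x ->
  (forall z, Omega z -> ((F (sqdist y z))%:E <= v z)%E) ->
  infty_laplacian p (radial y F) x <= 0.
Proof.
move=> d1 d2 c2 Ox vx vF.
pose Q := (fun t : R => - t ^+ 2).
have q1 (t : R) : is_derive t 1 Q (- (2 * t)).
  by apply: is_derive_eq; rewrite /GRing.scale /=; ring.
have q2 (t : R) : is_derive t 1 (fun t : R => - (2 * t)) (- 2).
  by apply: is_derive_eq; rewrite /GRing.scale /=; ring.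
pose phi z := radial y F z + radial x Q z.
pose D i z := radial_grad y dF i z + radial_grad x (fun t => - (2 * t)) i z.
pose H i j z := radial_hess y dF ddF i j z +
  radial_hess x (fun t => - (2 * t)) (fun=> - 2) i j z.
have dphi i z : is_derive z (delta_mx 0 i) phi (D i z).
  by apply: is_derive_addR; apply: is_derive_radial.
have dD i j z : is_derive z (delta_mx 0 j) (D i) (H i j z).
  by apply: is_derive_addR; apply: is_derive_radial_grad.
have cQ : continuous (fun t : R => - (2 * t)) by exact: is_derive_continuous q2.
have Cphi : Ck 2 Omega phi.
  apply: (@Ck2_of_partials _ _ _ _ D H) => //.
  - move=> z; apply: continuous_addR; apply: continuous_radial.
      exact: is_derive_continuous d1.
    exact: is_derive_continuous q1.
  - move=> i z; apply: continuous_addR; apply: continuous_radial_grad => //.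
    exact: is_derive_continuous d2.
  - move=> i j z; apply: continuous_addR; apply: continuous_radial_hess => //.
    by move=> t; exact: cst_continuous.
have xx0 : sqdist x x = 0 by apply/eqP; rewrite sqdist_eq0.
have [_ _ touch] := superv.
have Ephi i : partial i phi = D i.
  by apply/funext => z; exact: partial_is_derive.
have Erad i : partial i (radial y F) = radial_grad y dF i.
  by apply/funext => z; apply: partial_is_derive; exact: is_derive_radial.
have Dx i : D i x = radial_grad y dF i x.
  by rewrite /D /radial_grad xx0 mulr0 oppr0 mul0r addr0.
have := touch x phi Ox Cphi.
rewrite {1}/phi /radial xx0 /Q expr0n oppr0 addr0 => /(_ vx) => h.
have {}h : infty_laplacian p phi x <= 0.
  apply: h => z Oz zx; apply: lt_le_trans (vF z Oz).
  rewrite lte_fin /phi /radial /Q gtrDl oppr_lt0 exprn_gt0// lt_def.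
  by rewrite sqdist_eq0 zx sqdist_ge0.
have gE : grad (radial y F) x = grad phi x.
  by apply/rowP => i; rewrite !mxE Ephi Erad Dx.
have hE i j : partial j (partial i (radial y F)) x =
    partial j (partial i phi) x.
  rewrite Ephi Erad (partial_is_derive (dD i j x)).
  rewrite (partial_is_derive (is_derive_radial_grad y d2 i j x)).
  by rewrite /H /radial_hess !subrr !mulr0 xx0 mulr0 oppr0 mulr0 mul0r !addr0.
rewrite /infty_laplacian gE.
under eq_bigr do under eq_bigr do rewrite hE !Erad -!Dx -!Ephi.
exact: h.
Qed.

(** The gradient of F(|x - y|^2) is radial, so the Hessian only enters through
    its radial second derivative 4 F'' t + 2 F', where t = |x - y|^2. *)
Lemma infty_laplacian_radial (y x : 'rV[R]_n) (F dF ddF : R -> R) :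
  (forall t : R, is_derive t 1 F (dF t)) ->
  (forall t : R, is_derive t 1 dF (ddF t)) ->
  let t := sqdist y x in
  let k := 2 * `|dF t| * Num.sqrt t in
  enorm (grad (radial y F) x) = k /\
  infty_laplacian p (radial y F) x =
    k ^+ 2 * (4 * ddF t * t + 2 * dF t) +
    k ^+ 2 * ln k * dotp (grad (radial y F) x) (grad (fun z => ln (p z)) x).
Proof.
move=> d1 d2 t k.
have Erad i : partial i (radial y F) = radial_grad y dF i.
  by apply/funext => z; apply: partial_is_derive; exact: is_derive_radial.
have gE : grad (radial y F) x = (2 * dF t) *: (x - y).
  by apply/rowP => i; rewrite !mxE Erad /radial_grad -/t; ring.
have kE : enorm (grad (radial y F) x) = k.
  by rewrite gE enormZ normrM (ger0_norm (_ : 0 <= 2))// /k /t sqdist_enorm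
    sqrtr_sqr (ger0_norm (enorm_ge0 _)).
split=> //; rewrite /infty_laplacian kE; congr (_ + _).
have k2 : k ^+ 2 = 4 * dF t ^+ 2 * t.
  by rewrite /k !exprMn real_normK ?num_real// sqr_sqrtr ?sqdist_ge0//; ring.
transitivity (\sum_(i < n) (16 * dF t ^+ 2 * ddF t * t + 8 * dF t ^+ 3) *
    (x 0 i - y 0 i) ^+ 2).
  apply: eq_bigr => i _.
  transitivity (\sum_(j < n) (16 * dF t ^+ 2 * ddF t * (x 0 i - y 0 i) ^+ 2 *
      (x 0 j - y 0 j) ^+ 2 +
      (i == j)%:R * (8 * dF t ^+ 3 * (x 0 i - y 0 i) * (x 0 j - y 0 j)))).
    apply: eq_bigr => j _; rewrite !Erad.
    rewrite (partial_is_derive (is_derive_radial_grad y d2 i j x)).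
    by rewrite /radial_hess /radial_grad -/t; ring.
  rewrite big_split /= -mulr_sumr -sqdistE -/t [X in _ + X](bigD1 i) //= eqxx.
  rewrite big1 => [|j ji]; last by rewrite eq_sym (negbTE ji) mul0r.
  rewrite addr0 mulr1n mul1r -/t.
  by ring.
by rewrite -mulr_sumr -sqdistE -/t k2; ring.
Qed.

(** The logarithmic term has size at most k^3 |ln k| n L, because the drift is
    paired with a gradient of length k; dividing by k^2 leaves a scalar
    differential inequality for the profile. *)
Lemma supersolution_radial_ineq (L : R) (y x : 'rV[R]_n) (F dF ddF : R -> R) :
  (forall t : R, is_derive t 1 F (dF t)) ->
  (forall t : R, is_derive t 1 dF (ddF t)) -> continuous ddF ->
  Omega x -> (F (sqdist y x))%:E = v x ->
  (forall z, Omega z -> ((F (sqdist y z))%:E <= v z)%E) ->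
  (forall i, `|partial i (fun z => ln (p z)) x| <= L) ->
  let t := sqdist y x in
  let k := 2 * `|dF t| * Num.sqrt t in
  0 < k -> 4 * ddF t * t + 2 * dF t <= n%:R * L * (k * `|ln k|).
Proof.
move=> d1 d2 c2 Ox vx vF pL t k k0.
have := supersolution_radial d1 d2 c2 Ox vx vF.
have [kE ->] := infty_laplacian_radial y x d1 d2.
rewrite -/t -/k -(mulrA (k ^+ 2) (ln k)) -mulrDr pmulr_rle0 ?exprn_gt0// => h.
have dle : `|dotp (grad (radial y F) x) (grad (fun z => ln (p z)) x)| <=
    k * (n%:R * L).
  have <- : enorm (grad (radial y F) x) = k by exact: kE.
  by apply: dotp_le_bounded => i; rewrite mxE.
rewrite -subr_le0 (le_trans _ h)// lerD2l.
rewrite lerNl (le_trans (ler_norm _))// normrN normrM.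
rewrite (le_trans (ler_wpM2l (normr_ge0 _) dle))//.
by rewrite (_ : _ * (k * _) = n%:R * L * (k * `|ln k|)) //; ring.
Qed.

End touching.

(** * Conical barriers *)

(** The cubic Taylor polynomial at s^2 of the square root. Composing a
    decreasing profile of |x - y| with it instead of with the square root
    removes the singularity at the vertex y. *)
Definition sqrt_taylor (R : realType) (s t : R) : R :=
  s + (2 * s)^-1 * (t - s ^+ 2) - (8 * s ^+ 3)^-1 * (t - s ^+ 2) ^+ 2 +
  (16 * s ^+ 5)^-1 * (t - s ^+ 2) ^+ 3.

Definition sqrt_taylor' (R : realType) (s t : R) : R :=
  (2 * s)^-1 - (4 * s ^+ 3)^-1 * (t - s ^+ 2) +
  3 * (16 * s ^+ 5)^-1 * (t - s ^+ 2) ^+ 2.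

Definition sqrt_taylor'' (R : realType) (s t : R) : R :=
  - (4 * s ^+ 3)^-1 + 6 * (16 * s ^+ 5)^-1 * (t - s ^+ 2).

Lemma is_derive_sqrt_taylor (R : realType) (s t : R) : s != 0 ->
  is_derive t 1 (sqrt_taylor s) (sqrt_taylor' s t).
Proof.
move=> s0; apply: is_derive_eq.
by rewrite /GRing.scale /sqrt_taylor' /=; field.
Qed.

Lemma is_derive_sqrt_taylor' (R : realType) (s t : R) : s != 0 ->
  is_derive t 1 (sqrt_taylor' s) (sqrt_taylor'' s t).
Proof.
move=> s0; apply: is_derive_eq.
by rewrite /GRing.scale /sqrt_taylor'' /=; field.
Qed.

(** The fourth derivative of the square root is negative, so its Taylor
    polynomials of odd degree lie above it. *)
Lemma sqrt_le_taylor (R : realType) (s r : R) : 0 < s -> 0 <= r ->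
  r <= sqrt_taylor s (r ^+ 2).
Proof.
move=> s0 r0; rewrite -subr_ge0.
have -> : sqrt_taylor s (r ^+ 2) - r =
    (r - s) ^+ 4 * (r ^+ 2 + 4 * s * r + 5 * s ^+ 2) / (16 * s ^+ 5).
  by rewrite /sqrt_taylor; field; rewrite gt_eqF.
apply: divr_ge0; last by rewrite mulr_ge0// exprn_ge0// ltW.
by rewrite mulr_ge0 ?exprn_even_ge0// !addr_ge0 ?sqr_ge0// ?mulr_ge0 ?sqr_ge0// ltW.
Qed.

(** The barrier a exp(- alpha |z - y|) + c is not smooth at y. Replacing |z - y|
    by the Taylor polynomial of the square root in |z - y|^2 gives a smooth
    function that lies below the barrier and agrees with it to second order at
    x, so it may be used as a test function. Its slope at x is
    k = a alpha exp(- alpha |x - y|) and its radial second derivative is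
    alpha k. *)
Lemma cone_touch (R : realType) (n : nat) (Omega : set 'rV[R]_n)
    (p : 'rV[R]_n -> R) (v : 'rV[R]_n -> \bar R) (y x : 'rV[R]_n)
    (a c alpha L : R) :
  viscosity_supersolution Omega p v -> Omega x -> x != y ->
  0 < a -> 0 < alpha ->
  (a * expR (- (alpha * enorm (x - y))) + c)%:E = v x ->
  (forall z, Omega z ->
    ((a * expR (- (alpha * enorm (z - y))) + c)%:E <= v z)%E) ->
  (forall i, `|partial i (fun z => ln (p z)) x| <= L) ->
  alpha <= n%:R * L * `|ln (a * alpha * expR (- (alpha * enorm (x - y))))|.
Proof.
move=> superv Ox xy a0 al0 vx vle pL.
set s := enorm (x - y) in vx *.
have s0 : 0 < s by rewrite lt_def enorm_ge0 enorm_sub_eq0 xy.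
have sN0 : s != 0 by rewrite gt_eqF.
set E := expR _.
pose F t := a * expR (- (alpha * sqrt_taylor s t)) + c.
pose dF t := - (alpha * a) * (expR (- (alpha * sqrt_taylor s t)) *
  sqrt_taylor' s t).
pose ddF t := - (alpha * a) * (expR (- (alpha * sqrt_taylor s t)) *
  (sqrt_taylor'' s t - alpha * sqrt_taylor' s t ^+ 2)).
have dT (t : R) := is_derive_sqrt_taylor t sN0.
have dT' (t : R) := is_derive_sqrt_taylor' t sN0.
have dE (t : R) : is_derive t 1 (fun t => expR (- (alpha * sqrt_taylor s t)))
   (expR (- (alpha * sqrt_taylor s t)) * (- (alpha * sqrt_taylor' s t))).
  by apply: (is_derive_compR (is_derive_expR _)); apply: is_derive_eq.
have d1 (t : R) : is_derive t 1 F (dF t).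
  by apply: is_derive_eq; rewrite /GRing.scale /dF /=; ring.
have d2 (t : R) : is_derive t 1 dF (ddF t).
  by apply: is_derive_eq; rewrite /GRing.scale /ddF /=; ring.
have cE : continuous (fun t => expR (- (alpha * sqrt_taylor s t))).
  exact: is_derive_continuous dE.
have cT' : continuous (sqrt_taylor' s) by exact: is_derive_continuous dT'.
have cT'' : continuous (sqrt_taylor'' s).
  apply: (@is_derive_continuous _ _ (fun=> 6 * (16 * s ^+ 5)^-1)) => t.
  by apply: is_derive_eq; rewrite /GRing.scale /=; ring.
have c2 : continuous ddF.
  move=> t; apply: (@continuous_mulR _ _ (fun=> - (alpha * a))
    (fun t => expR (- (alpha * sqrt_taylor s t)) *
    (sqrt_taylor'' s t - alpha * sqrt_taylor' s t ^+ 2)) t).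
    exact: cst_continuous.
  apply: continuous_mulR; first exact: cE.
  apply: continuous_addR; first exact: cT''.
  apply: continuousN; apply: continuous_mulR; first exact: cst_continuous.
  by apply: continuous_mulR; exact: cT'.
have ts : sqdist y x = s ^+ 2 by rewrite sqdist_enorm.
have T0 : sqrt_taylor s (s ^+ 2) = s by rewrite /sqrt_taylor; field.
have T1 : sqrt_taylor' s (s ^+ 2) = (2 * s)^-1 by rewrite /sqrt_taylor'; field.
have T2 : sqrt_taylor'' s (s ^+ 2) = - (4 * s ^+ 3)^-1.
  by rewrite /sqrt_taylor''; field.
have := @supersolution_radial_ineq R n Omega p v superv L y x F dF ddF d1 d2 c2 Ox.
rewrite ts {1 2}/F T0 => /(_ vx) H.
have {H} := H _ pL.
rewrite /dF /ddF T0 T1 T2 -/E sqrtr_sqr (gtr0_norm s0).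
have E0 : 0 < E by exact: expR_gt0.
(* These are the slope k and the radial second derivative alpha k. *)
have -> : 2 * `|- (alpha * a) * (E * (2 * s)^-1)| * s = a * alpha * E.
  rewrite mulNr normrN gtr0_norm; first by field.
  by rewrite !mulr_gt0// invr_gt0 mulr_gt0.
have -> : 4 * (- (alpha * a) * (E * (- (4 * s ^+ 3)^-1 -
    alpha * (2 * s)^-1 ^+ 2))) * s ^+ 2 +
    2 * (- (alpha * a) * (E * (2 * s)^-1)) = a * alpha * E * alpha by field.
move=> H.
have k0 : 0 < a * alpha * E by rewrite !mulr_gt0.
rewrite -(ler_pM2l k0) mulrCA; apply: H => //.
move=> z Oz; apply: le_trans (vle z Oz).
rewrite lee_fin /F lerD2r ler_pM2l// ler_expR lerN2 ler_pM2l//.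
by rewrite sqdist_enorm sqrt_le_taylor ?enorm_ge0.
Qed.

(** With m the height of the barrier above its zero sphere of radius rho, its
    slopes lie between (m / rho) exp(- alpha rho) and (m / rho) exp(alpha rho).
    Their logarithms are therefore at most ln (m / rho) + alpha rho in absolute
    value, and the choice of alpha beats K times this bound: ln (m / rho) uses
    up one half of alpha, and alpha rho one quarter since K rho <= 1/4. *)
Lemma barrier_slope (R : realType) (m rho K s alpha : R) :
  0 < rho -> rho <= m -> 0 <= K -> K * rho <= 4^-1 -> 0 <= s <= rho ->
  alpha = 1 + 2 * K * ln (m / rho) ->
  K * `|ln (m / (1 - expR (- (alpha * rho))) * alpha * expR (- (alpha * s)))| <
  alpha.
Proof.
move=> rho0 rhom K0 Krho s01 alphaE; have [s0 srho] := andP s01.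
have m0 : 0 < m by exact: lt_le_trans rho0 rhom.
have l0 : 0 <= ln (m / rho) by rewrite ln_ge0// ler_pdivlMr// mul1r.
have al1 : 1 <= alpha by rewrite alphaE lerDl !mulr_ge0.
have al0 : 0 < alpha by rewrite (lt_le_trans _ al1).
set A := alpha * rho; have A0 : 0 < A by rewrite mulr_gt0.
set B := 1 - expR (- A).
have BA : B <= A by have := expR_ge1Dx (- A); rewrite /B; lra.
have eA0 : 0 < expR (- A) by exact: expR_gt0.
have AB : A * expR (- A) <= B.
  have := expR_ge1Dx A; rewrite -(ler_pM2r eA0) -expRD subrr expR0 /B; lra.
have B0 : 0 < B by rewrite (lt_le_trans _ AB)// mulr_gt0.
set q := m / B * alpha; have q0 : 0 < q by rewrite !mulr_gt0// invr_gt0.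
have mr0 : 0 < m / rho by rewrite divr_gt0.
have lq : ln (m / rho) <= ln q.
  rewrite ler_ln ?posrE// ler_pdivrMr// /q -!mulrA ler_pMr//.
  by rewrite mulrC -/A ler_pdivlMr// mul1r.
have ql : ln q <= ln (m / rho) + A.
  rewrite -[X in _ + X]expRK -lnM ?posrE ?expR_gt0//.
  rewrite ler_ln ?posrE ?mulr_gt0 ?expR_gt0// ?invr_gt0//.
  rewrite /q mulrAC ler_pdivrMr// -!mulrA ler_pM2l//.
  by rewrite ler_pdivlMl// mulrC -/A -ler_pdivrMl ?expR_gt0// -expRN mulrC.
rewrite lnM ?posrE ?expR_gt0// expRK.
have As : 0 <= alpha * s <= A by rewrite mulr_ge0 ?(ltW al0)//= ler_pM2l.
have : `|ln q + - (alpha * s)| <= ln (m / rho) + A.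
  by move/andP: As => [? ?]; rewrite ler_norml; apply/andP; split; lra.
move/(ler_wpM2l K0)/le_lt_trans; apply.
have KA : K * A <= alpha / 4 by rewrite mulrCA ler_pM2l.
by move: KA; rewrite mulrDr alphaE; lra.
Qed.

(** * Local and chained Harnack estimates *)

Section comparison.
Variables (R : realType) (n : nat) (Omega : set 'rV[R]_n) (p : 'rV[R]_n -> R).
Variables (v : 'rV[R]_n -> \bar R) (U : 'rV[R]_n -> R) (L : R).
Hypothesis superv : viscosity_supersolution Omega p v.
Hypothesis vU : forall x, Omega x -> v x = (U x)%:E.
Hypothesis U_ge0 : forall x, Omega x -> 0 <= U x.
Hypothesis contU : forall x, Omega x -> {for x, continuous U}.
Hypothesis L_ge0 : 0 <= L.
Hypothesis pL : forall i x, Omega x -> `|partial i (fun z => ln (p z)) x| <= L.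

(** The barrier has the height U y at the vertex and vanishes at distance rho.
    Outside that ball it is negative while U is nonnegative, so that if U were
    somewhere below it, the difference would have a negative minimum over Omega.
    The minimum is not attained at the vertex, where the difference vanishes;
    elsewhere the conditions of cone_touch and barrier_slope on alpha exclude
    each other. *)
Lemma cone_comparison (y : 'rV[R]_n) (rho : R) :
  0 < rho -> rho <= U y -> n%:R * L * rho <= 4^-1 ->
  [set z | enorm (z - y) <= rho] `<=` Omega ->
  let alpha := 1 + 2 * (n%:R * L) * ln (U y / rho) in
  forall x, Omega x ->
  U y * (expR (- (alpha * enorm (x - y))) - expR (- (alpha * rho))) /
    (1 - expR (- (alpha * rho))) <= U x.
Proof.
move=> rho0 rhoU Lrho ballO alpha x Ox.
have K0 : 0 <= n%:R * L by rewrite mulr_ge0.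
set e := expR (- (alpha * rho)).
have l0 : 0 <= ln (U y / rho) by rewrite ln_ge0// ler_pdivlMr// mul1r.
have al1 : 1 <= alpha by rewrite lerDl !mulr_ge0.
have al0 : 0 < alpha by rewrite (lt_le_trans _ al1).
have e1 : 0 < 1 - e by rewrite subr_gt0 -expR0 ltr_expR oppr_lt0 mulr_gt0.
have m0 : 0 < U y by exact: lt_le_trans rho0 rhoU.
set a := U y / (1 - e).
have a0 : 0 < a by rewrite divr_gt0.
pose G (z : 'rV[R]_n) := a * expR (- (alpha * enorm (z - y))) - a * e.
rewrite (_ : _ / _ = G x); last by rewrite /G /a; ring.
have cG : continuous G.
  have cn (c : 'rV[R]_n) : {for c, continuous (fun z : 'rV[R]_n => enorm (z - y))}.
    exact: continuous_enorm_sub.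
  move=> z; apply: (@continuous_addR _ _
    (fun z : 'rV[R]_n => a * expR (- (alpha * enorm (z - y)))) (fun=> - (a * e)) z).
    apply: continuous_mulR; first exact: cst_continuous.
    apply: (@continuous_comp _ _ _ (fun z : 'rV[R]_n => - (alpha * enorm (z - y))) expR).
      apply: continuousN; apply: continuous_mulR; first exact: cst_continuous.
      exact: cn.
    exact: continuous_expR.
  exact: cst_continuous.
have Gout z : rho <= enorm (z - y) -> G z <= 0.
  move=> h; rewrite subr_le0 ler_pM2l// /e ler_expR lerN2.
  by rewrite ler_pM2l.
pose Kb := [set z : 'rV[R]_n | enorm (z - y) <= rho].
rewrite leNgt; apply/negP => UGx.
have xK : Kb x.
  rewrite /Kb /= leNgt; apply/negP => /ltW/Gout Gx.
  by have := U_ge0 Ox; lra.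
have [c cK cmin] : exists2 c, c \in Kb &
    forall t, t \in Kb -> U c - G c <= U t - G t.
  have cUG : {within Kb, continuous (fun t => U t - G t)}.
    apply: continuous_in_subspaceT => z; rewrite inE => /ballO Oz.
    apply: (@continuous_addR _ _ U (fun t => - G t) z); first exact: contU.
    by apply: continuousN; exact: cG.
  exact: (compact_EVT_min (ex_intro _ x xK) (@compact_closed_eball _ _ y rho) cUG).
have {}cmin z : Omega z -> U c - G c <= U z - G z.
  move=> Oz; have [zrho|/ltW/Gout Gz] := leP (enorm (z - y)) rho.
    have zK : z \in Kb by rewrite inE.
    exact: cmin.
  apply: (le_trans (cmin x (mem_set xK))); apply: (@le_trans _ _ 0).
    by rewrite subr_le0 ltW.
  by rewrite subr_ge0 (le_trans Gz)// U_ge0.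
have Uc0 : U c - G c < 0 by rewrite (le_lt_trans (cmin _ Ox))// subr_lt0.
have Oc : Omega c by apply: ballO; rewrite inE in cK.
have cy : c != y.
  apply/eqP => cy; move: Uc0; rewrite cy /G subrr.
  rewrite (_ : enorm 0 = 0); last by rewrite -(subrr y); apply/eqP; rewrite enorm_sub_eq0.
  rewrite mulr0 oppr0 expR0 -mulrBr /a mulfVK ?gt_eqF// subrr ltxx//.
have cv : (a * expR (- (alpha * enorm (c - y))) + (U c - G c - a * e))%:E = v c.
  by rewrite vU// /G; congr (_%:E); ring.
have := cone_touch superv Oc cy a0 al0 cv.
have srho : 0 <= enorm (c - y) <= rho.
  by rewrite enorm_ge0; rewrite inE in cK.
move=> touch; have := barrier_slope rho0 rhoU K0 Lrho srho (erefl alpha).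
rewrite -/e -/a ltNge => /negP; apply.
apply: touch => [z Oz|i]; last exact: pL.
rewrite vU// lee_fin (_ : _ + _ = G z + (U c - G c)); last by rewrite /G; ring.
by rewrite -lerBrDl cmin.
Qed.

(** If U y < rho the term rho alone suffices. Otherwise the barrier still has a
    fixed fraction of its height at distance rho / 2, because alpha rho stays
    bounded as rho tends to 0: rho ln (U y / rho) <= U y <= M. This is the only
    place where the upper bound M of U enters the constant. *)
Lemma local_Harnack (y x : 'rV[R]_n) (rho M D : R) :
  0 < rho -> n%:R * L * rho <= 4^-1 -> rho <= D -> U y <= M ->
  [set z | enorm (z - y) <= rho] `<=` Omega ->
  enorm (x - y) <= rho / 2 ->
  U y + rho <= 2 * expR (D + 2 * (n%:R * L) * M) * (U x + rho).
Proof.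
move=> rho0 Lrho rhoD UM ballO xy.
have Oy : Omega y.
  apply: ballO => /=; rewrite (_ : enorm _ = 0) ?ltW//.
  by apply/eqP; rewrite enorm_sub_eq0.
have Ox : Omega x by apply: ballO => /=; lra.
have Ux := U_ge0 Ox; have Uy := U_ge0 Oy.
have K0 : 0 <= n%:R * L by rewrite mulr_ge0.
set C := expR _.
have C1 : 1 <= C by rewrite -expR0 ler_expR; rewrite addr_ge0 ?mulr_ge0//; lra.
have [mrho|rhom] := leP (U y) rho.
  have : 1 * (U x + rho) <= C * (U x + rho) by apply: ler_wpM2r => //; lra.
  lra.
have := cone_comparison rho0 (ltW rhom) Lrho ballO Ox.
set alpha := 1 + _; set e := expR (- (alpha * rho)) => h.
have l0 : 0 <= ln (U y / rho) by rewrite ln_ge0// ler_pdivlMr// mul1r ltW.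
have al1 : 1 <= alpha by rewrite lerDl !mulr_ge0.
have al0 : 0 < alpha by rewrite (lt_le_trans _ al1).
have m0 : 0 < U y by exact: lt_trans rho0 rhom.
pose w := expR (- (alpha * (rho / 2))).
have w0 : 0 < w by exact: expR_gt0.
have w1 : w < 1 by rewrite -expR0 ltr_expR oppr_lt0 !mulr_gt0// invr_gt0.
have ew : e = w ^+ 2 by rewrite expr2 -expRD /e; congr expR; field.
have wx : w <= expR (- (alpha * enorm (x - y))).
  by rewrite ler_expR lerN2 ler_pM2l.
have Uw : U y * w <= 2 * U x.
  have : U y * (w - e) / (1 - e) <= U x.
    apply: le_trans h; rewrite ler_pM2r; last first.
      by rewrite invr_gt0 ew subr_gt0 expr_lte1// ltW.
    by rewrite ler_pM2l// lerD2r.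
  rewrite (_ : U y * (w - e) / (1 - e) = U y * w / (1 + w)); last first.
    by rewrite ew; field; apply/andP; split; rewrite gt_eqF//; nra.
  rewrite ler_pdivrMr; last lra.
  by move=> h'; apply: (le_trans h'); rewrite mulrC ler_wpM2r//; lra.
have wC : 1 <= w * C.
  rewrite -expRD -[X in X <= _]expR0 ler_expR.
  have lr : ln (U y / rho) * rho <= U y.
    rewrite -ler_pdivlMr//.
    have := expR_ge1Dx (ln (U y / rho)); rewrite lnK ?posrE ?divr_gt0//; lra.
  have : alpha * rho <= D + 2 * (n%:R * L) * M.
    rewrite /alpha mulrDl mul1r lerD// -mulrA ler_wpM2l ?mulr_ge0//.
    exact: le_trans lr UM.
  have : 0 <= alpha * rho by rewrite ltW// mulr_gt0.
  by rewrite (mulrA alpha); move: (alpha * rho) (D + _) => A B; lra.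
have : U y * 1 <= U y * (w * C) by rewrite ler_pM2l.
rewrite mulrA mulr1 => h1.
have : U y * w * C <= 2 * U x * C by rewrite ler_wpM2r//; lra.
have : 1 * rho <= C * rho by rewrite ler_pM2r.
have : 0 <= C * rho by rewrite mulr_ge0 ?ltW//; lra.
lra.
Qed.

(** Local estimates are chained along the segment from y to x, in 4 N steps of
    length at most rho / 2 with rho = r / N. The number N does not depend on
    r, because the smallness condition on rho is relative to the bound D of
    all admissible radii. *)
Lemma Harnack_chain (x0 y x : 'rV[R]_n) (r M D : R) (N : nat) :
  0 < r -> r <= D -> (0 < N)%N -> n%:R * L * D <= N%:R / 4 ->
  eball x0 (2 * r) `<=` Omega ->
  (forall z, eball x0 (2 * r) z -> U z <= M) ->
  eball x0 r y -> eball x0 r x ->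
  U y <= (2 * expR (D + 2 * (n%:R * L) * M)) ^+ (4 * N) * (U x + r).
Proof.
move=> r0 rD N0 ND ballO UM yr xr.
set C := 2 * _; have C0 : 0 <= C by rewrite mulr_ge0// expR_ge0.
have NR : 0 < N%:R :> R by rewrite ltr0n.
have N1 : 1 <= N%:R :> R by rewrite ler1n.
pose rho := r / N%:R; have rho0 : 0 < rho by rewrite divr_gt0.
have rhor : rho <= r by rewrite ler_pdivrMr// ler_peMr// ltW.
have Lrho : n%:R * L * rho <= 4^-1.
  rewrite /rho mulrA ler_pdivrMr// [leRHS]mulrC; apply: le_trans ND.
  by rewrite ler_wpM2l// mulr_ge0.
pose z (i : nat) : 'rV[R]_n := y + (i%:R / (4 * N)%:R) *: (x - y).
have N4 : 0 < (4 * N)%:R :> R by rewrite ltr0n muln_gt0.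
have zr i : (i <= 4 * N)%N -> eball x0 r (z i).
  move=> iN; set t : R := i%:R / (4 * N)%:R.
  have t0 : 0 <= t by rewrite divr_ge0.
  have t1 : t <= 1 by rewrite ler_pdivrMr// mul1r ler_nat.
  rewrite /eball /= (_ : z i - x0 = (1 - t) *: (y - x0) + t *: (x - x0)).
    rewrite (le_lt_trans (enorm_triangle _ _))// !enormZ !ger0_norm ?subr_ge0//.
    move: yr xr; rewrite /eball /=.
    move: (enorm (y - x0)) (enorm (x - x0)) => a b ar br.
    have [->|tN1] := eqVneq t 1; first by rewrite subrr mul0r add0r mul1r.
    have t1' : 0 < 1 - t by rewrite subr_gt0 lt_neqAle tN1.
    have : (1 - t) * a < (1 - t) * r by rewrite ltr_pM2l.
    have : t * b <= t * r by rewrite ler_wpM2l// ltW.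
    lra.
  by rewrite /z -/t; apply/rowP => j; rewrite !mxE; ring.
have step i : (i < 4 * N)%N -> U (z i) + rho <= C * (U (z i.+1) + rho).
  move=> iN; have zir := zr i (ltnW iN).
  apply: local_Harnack => //.
  - exact: le_trans rhor rD.
  - apply: UM; move: zir; rewrite /eball /=; lra.
  - move=> w /= wz; apply: ballO; rewrite /eball /=.
    rewrite (le_lt_trans (enorm_sub_triangle _ (z i) _))//.
    by move: zir; rewrite /eball /=; lra.
  rewrite (_ : z i.+1 - z i = (4 * N)%:R^-1 *: (x - y)); last first.
    by apply/rowP => j; rewrite !mxE -natr1; ring.
  rewrite enormZ gtr0_norm ?invr_gt0// mulrC ler_pdivrMr//.
  have -> : rho / 2 * (4 * N)%:R = 2 * r.
    by rewrite /rho natrM; field; rewrite gt_eqF.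
  rewrite (le_trans (enorm_sub_triangle _ x0 _))// (enorm_sub_sym x0).
  by move: xr yr; rewrite /eball /=; lra.
have chain i : (i <= 4 * N)%N -> U y + rho <= C ^+ i * (U (z i) + rho).
  elim: i => [_|i IH iN].
    by rewrite /z mul0r scale0r addr0 expr0 mul1r.
  apply: (le_trans (IH (ltnW iN))).
  by rewrite exprSr -mulrA ler_wpM2l ?exprn_ge0// step.
have := chain _ (leqnn _).
have -> : z (4 * N)%N = x by rewrite /z divff ?gt_eqF// scale1r addrC subrK.
move=> h.
have : C ^+ (4 * N) * (U x + rho) <= C ^+ (4 * N) * (U x + r).
  by rewrite ler_wpM2l ?exprn_ge0// lerD2l.
lra.
Qed.

End comparison.

(** * Translation invariance of Lebesgue measure *)

Section borel.
Variables (R : realType) (n : nat).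

Lemma open_borel (A : set 'rV[R]_n) :
  open A -> measurable (A : set (borelRn R n)).
Proof. exact: sub_sigma_algebra. Qed.

Lemma closed_borel (A : set 'rV[R]_n) :
  closed A -> measurable (A : set (borelRn R n)).
Proof.
move=> cA; rewrite -[A]setCK; apply: measurableC.
by apply: open_borel; exact: closed_openC.
Qed.

Lemma continuous_on_borel (Omega : set 'rV[R]_n) (f : 'rV[R]_n -> R) :
  open Omega -> (forall x, Omega x -> {for x, continuous f}) ->
  measurable_fun (Omega : set (borelRn R n)) (f : borelRn R n -> R).
Proof.
move=> oO cf; apply: (measurability (@measurable_realfun.RGenOInfty.G R)).
  exact: measurable_realfun.RGenOInfty.measurableE.
move=> _ [_ [a ->] <-]; apply: open_borel.
rewrite openE => x [Ox ax]; rewrite /interior.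
apply: filterI; first exact: open_nbhs_nbhs.
by apply: cf => //; exact: open_nbhs_nbhs.
Qed.

Lemma continuous_borel (f : 'rV[R]_n -> R) :
  continuous f -> measurable_fun setT (f : borelRn R n -> R).
Proof.
by move=> cf; apply: continuous_on_borel => [|x _]; [exact: openT|exact: cf].
Qed.

Lemma borel_translation (h : 'rV[R]_n) :
  measurable_fun setT ((fun x => x + h) : borelRn R n -> borelRn R n).
Proof.
apply: (@measurability _ _ (borelRn R n) (borelRn R n) setT _
  (@open 'rV[R]_n)) => // _ [A oA <-]; rewrite setTI.
apply: open_borel; apply: open_comp => // x _.
by apply: continuousD; [exact: cvg_id|exact: cst_continuous].
Qed.

Definition box (a b : 'rV[R]_n) : set 'rV[R]_n :=
  [set x | forall i, a 0 i <= x 0 i < b 0 i].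

Definition boxes : set (set 'rV[R]_n) := [set A | exists a b, A = box a b].

(** Every open set is the union of the rational boxes that it contains, and
    there are countably many of those. *)
Lemma open_sigma_boxes (U : set 'rV[R]_n) : open U -> <<s boxes >> U.
Proof.
move=> oU.
pose r (q : 'rV[rat]_n) : 'rV[R]_n := map_mx ratr q.
pose F (q : 'rV[rat]_n * 'rV[rat]_n) : set 'rV[R]_n :=
  if `[< box (r q.1) (r q.2) `<=` U >] then box (r q.1) (r q.2) else set0.
have -> : U = \bigcup_q F q.
  apply/seteqP; split=> [x Ux|x [q _]]; last first.
    by rewrite /F; case: asboolP => // bU; exact: bU.
  have /nbhs_ballP[e e0 eU] : nbhs x U by exact: open_nbhs_nbhs.
  have Q (i : 'I_n) : exists q : rat * rat,
      [/\ x 0 i - e < ratr q.1, ratr q.1 < x 0 i, x 0 i < ratr q.2 &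
        ratr q.2 < x 0 i + e].
    have [|a] := @rat_in_itvoo R (x 0 i - e) (x 0 i); first by rewrite ltrBlDr ltrDl.
    have [|b] := @rat_in_itvoo R (x 0 i) (x 0 i + e); first by rewrite ltrDl.
    rewrite !in_itv /= => /andP[? ?] /andP[? ?].
    by exists (a, b).
  pose q i := projT1 (cid (Q i)).
  have qP i := projT2 (cid (Q i)).
  exists (\row_i (q i).1, \row_i (q i).2) => //.
  rewrite /F; case: asboolP => [_ i|nsub].
    by rewrite !mxE; have [_ /ltW -> -> _] := qP i.
  exfalso; apply: nsub => y yb; apply: eU; split=> // i j.
  rewrite ord1; have := yb j; rewrite !mxE /=; have [] := qP j.
  rewrite -/(q j) /ball /= => ? ? ? ? /andP[? ?].
  by rewrite ltr_norml; apply/andP; split; lra.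
have -> : <<s boxes >> = @measurable _ (g_sigma_algebraType boxes) by [].
apply: countable_bigcupT_measurable => // q.
rewrite /F; case: asboolP => // _.
by apply: sub_sigma_algebra; exists (r q.1), (r q.2).
Qed.

Variable mu : {measure set (borelRn R n) -> \bar R}.
Hypothesis lebmu : is_lebesgue mu.

Lemma measurable_box (a b : 'rV[R]_n) : measurable (box a b : set (borelRn R n)).
Proof.
have -> : box a b = \bigcap_(i in [set: 'I_n])
    ((fun x : 'rV[R]_n => x 0 i) @^-1` [set t | a 0 i <= t < b 0 i]).
  by apply/seteqP; split=> x /= h i; [move=> _; exact: h|exact: h].
apply: fin_bigcap_measurable => // i _.
have := @continuous_borel (fun x => x 0 i) (@coord_continuous R 1 n 0 i).
move=> /(_ measurableT `[a 0 i, b 0 i[%classic (measurable_itv _)).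
by rewrite setTI set_itvE.
Qed.

Lemma box_empty (a b : 'rV[R]_n) :
  ~ (forall i, a 0 i <= b 0 i) -> box a b = set0.
Proof.
move=> nab; apply/seteqP; split=> // x xab; apply: nab => i.
by have /andP[/le_trans + /ltW] := xab i; apply.
Qed.

Lemma mu_box_fin (a b : 'rV[R]_n) : (mu (box a b) < +oo)%E.
Proof.
have [ab|nab] := pselect (forall i, a 0 i <= b 0 i).
  by rewrite lebmu// ltry.
by rewrite box_empty// measure0.
Qed.

(** The image measure under a translation has the same values on boxes, and
    boxes are stable under intersection and generate the Borel sets. *)
Lemma lebesgue_translation (h : 'rV[R]_n) (A : set (borelRn R n)) :
  measurable A -> mu ((fun x => x + h) @^-1` A) = mu A.
Proof.
move=> mA; pose T : borelRn R n -> borelRn R n := fun x => x + h.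
have mT : measurable_fun setT T by exact: borel_translation.
pose g (k : nat) : set (borelRn R n) := box (const_mx (- k%:R)) (const_mx k%:R).
have mE : @measurable _ (borelRn R n) = <<s boxes >>.
  apply/seteqP; split; apply: smallest_sub => //.
  - by move=> U; exact: open_sigma_boxes.
  - exact: sigma_algebra_measurable.
  - by move=> _ [a [b ->]]; exact: measurable_box.
have shift_box a b : T @^-1` box a b = box (a - h) (b - h).
  by apply/seteqP; split=> x /= H i; have := H i; rewrite !mxE lerBlDr ltrBrDr.
have cover : \bigcup_k g k = setT.
  apply/seteqP; split=> // x _.
  exists `|Num.ceil (`|x| + 1)|%N => // i; rewrite !mxE.
  have := coord_le_norm x i; rewrite ler_norml => /andP[x1 x2].
  have : `|x| + 1 <= `|Num.ceil (`|x| + 1)|%N%:R.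
    by rewrite natr_absz (le_trans (Num.Theory.ceil_ge _))// ler_int ler_norm.
  by move=> ?; apply/andP; split; lra.
have IB : setI_closed boxes.
  move=> _ _ [a [b ->]] [c [d ->]].
  exists (\row_i Num.max (a 0 i) (c 0 i)), (\row_i Num.min (b 0 i) (d 0 i)).
  apply/seteqP; split=> [x [/= H H'] i|x /= H]; last split=> i.
  - rewrite !mxE ge_max lt_min; have /andP[-> ->] := H i.
    by have /andP[-> ->] := H' i.
  - have := H i; rewrite !mxE ge_max lt_min.
    by move=> /andP[/andP[-> _] /andP[-> _]].
  - have := H i; rewrite !mxE ge_max lt_min.
    by move=> /andP[/andP[_ ->] /andP[_ ->]].
pose nu : {measure set (borelRn R n) -> \bar R} := pushforward mu T.
have := @measure_unique _ R (borelRn R n) boxes g mE IB _ cover (nu mT) mu _ _ A mA.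
apply.
- by move=> k; exists (const_mx (- k%:R)), (const_mx k%:R).
- move=> _ [a [b ->]]; rewrite /nu /= /pushforward shift_box.
  have [ab|nab] := pselect (forall i, a 0 i <= b 0 i).
    rewrite !lebmu//; last by move=> i; rewrite !mxE lerD2r.
    by congr (_%:E); apply: eq_bigr => i _; rewrite !mxE; ring.
  rewrite !box_empty// => H; apply: nab => i.
  by have := H i; rewrite !mxE lerD2r.
- by move=> k; rewrite /nu /= /pushforward shift_box mu_box_fin.
Qed.

End borel.
(** * Integrals of derivatives *)

Definition ceball (R : realType) (n : nat) (y : 'rV[R]_n) (r : R) :
  set 'rV[R]_n := [set x | enorm (x - y) <= r].

Lemma closed_ceball (R : realType) (n : nat) (y : 'rV[R]_n) (r : R) :
  closed (ceball y r).
Proof. exact: compact_closed (@compact_closed_eball R n y r). Qed.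

Section integration.
Variables (R : realType) (n : nat).
Variable mu : {measure set (borelRn R n) -> \bar R}.
Hypothesis lebmu : is_lebesgue mu.
Implicit Types (y h : 'rV[R]_n) (f k : 'rV[R]_n -> R) (r : R).

Lemma measurable_ceball y r : measurable (ceball y r : set (borelRn R n)).
Proof. by apply: closed_borel; exact: closed_ceball. Qed.

Lemma mu_ceball_fin y r : (mu (ceball y r) < +oo)%E.
Proof.
pose a : 'rV[R]_n := \row_i (y 0 i - r); pose b : 'rV[R]_n := \row_i (y 0 i + r + 1).
apply: le_lt_trans (mu_box_fin lebmu a b); apply: le_measure; rewrite ?inE.
- exact: measurable_ceball.
- exact: measurable_box.
move=> x xr i; have := le_trans (coord_le_enorm (x - y) i) xr.
by rewrite !mxE ler_norml => /andP[? ?]; apply/andP; split; lra.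
Qed.

Lemma bounded_of_support y r f : continuous f ->
  (forall x, ~ ceball y r x -> f x = 0) ->
  exists2 C : R, 0 <= C & forall x, `|f x| <= C.
Proof.
move=> cf f0; have [[x0 x0K]|K0] := pselect (ceball y r !=set0); last first.
  exists 0 => // x; rewrite f0 ?normr0// => xK; apply: K0; by exists x.
have cnf : {within ceball y r, continuous (fun x => `|f x|)}.
  apply: continuous_subspaceT => x.
  apply: (@continuous_comp _ _ _ f Num.norm); first exact: cf.
  exact: norm_continuous.
have [c cK cmax] := compact_EVT_max (ex_intro _ x0 x0K) (@compact_closed_eball _ _ y r) cnf.
exists `|f c| => // x; have [xK|xK] := pselect (ceball y r x).
  by apply: cmax; rewrite inE.
by rewrite f0// normr0.
Qed.

Lemma integrable_of_support y r f : continuous f ->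
  (forall x, ~ ceball y r x -> f x = 0) ->
  mu.-integrable [set: borelRn R n] (EFin \o f).
Proof.
move=> cf f0; have [C C0 fC] := bounded_of_support cf f0.
have mK := measurable_ceball y r.
rewrite (_ : EFin \o f = (EFin \o f) \_ (ceball y r)); last first.
  apply/funext => x; rewrite patchE; case: ifPn => //=.
  by rewrite notin_setE => /f0 ->.
apply/(integrable_mkcond _ mK); apply: measurable_bounded_integrable => //.
- exact: mu_ceball_fin.
- by apply: measurable_funTS; exact: continuous_borel.
- exists C; split; first exact: num_real.
  by move=> M CM x _; exact: le_trans (fC x) (ltW CM).
Qed.

Lemma continuous_translate f h : continuous f ->
  continuous (fun x : 'rV[R]_n => f (x + h)).
Proof.
move=> cf x; apply: (@continuous_comp _ _ _ (fun x : 'rV[R]_n => x + h) f);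
  last exact: cf.
by apply: continuousD; [exact: cvg_id|exact: cst_continuous].
Qed.

Lemma support_translate y r f h : (forall x, ~ ceball y r x -> f x = 0) ->
  forall x, ~ ceball (y - h) r x -> f (x + h) = 0.
Proof.
move=> f0 x xK; apply: f0 => H; apply: xK; move: H.
by rewrite /ceball /= opprB addrA.
Qed.

Lemma integral_translation y r f h : continuous f ->
  (forall x, ~ ceball y r x -> f x = 0) ->
  (\int[mu]_(x in [set: borelRn R n]) (f (x + h)%R)%:E =
   \int[mu]_(x in [set: borelRn R n]) (f x)%:E)%E.
Proof.
move=> cf f0.
have mT := borel_translation h.
have ifh : mu.-integrable [set: borelRn R n]
    (EFin \o (fun x : 'rV[R]_n => f (x + h))).
  exact: (@integrable_of_support (y - h) r _ (continuous_translate (h := h) cf)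
    (support_translate f0)).
have mf : measurable_fun [set: borelRn R n] (EFin \o f).
  by apply/measurable_EFinP; exact: continuous_borel.
pose T : borelRn R n -> borelRn R n := fun x => x + h.
pose nu : {measure set (borelRn R n) -> \bar R} := pushforward mu T.
transitivity (\int[nu mT]_(x in [set: borelRn R n]) (f x)%:E)%E.
  have H := integral_pushforward (mT : measurable_fun setT T) mf ifh measurableT.
  by rewrite [RHS]H preimage_setT.
apply: eq_measure_integral => A mA _.
exact: (lebesgue_translation lebmu h mA).
Qed.

Lemma is_derive_along (i : 'I_n) f k x (s : R) :
  (forall x, is_derive x (delta_mx 0 i) f (k x)) ->
  is_derive s 1 (fun s : R => f (s *: delta_mx 0 i + x))
    (k (s *: delta_mx 0 i + x)).
Proof.
move=> df; have /is_derive_line d0 := df (s *: delta_mx 0 i + x).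
pose F (t : R) := f (t *: delta_mx 0 i + (s *: delta_mx 0 i + x)).
have -> : (fun s : R => f (s *: delta_mx 0 i + x)) = fun t => F (t - s).
  by apply/funext => t; rewrite /F addrA -scalerDl subrK.
rewrite -[k _]mulr1; apply: (@is_derive_compR _ _ F (fun t : R => t - s)).
  by rewrite subrr.
by apply: is_derive_eq; rewrite subr0.
Qed.

(** The difference quotients of f have integral zero by translation
    invariance. By the mean value theorem they are dominated by a multiple of
    the indicator of a larger ball, and they converge to the derivative. *)
Lemma integral_partial_eq0 y r f k (i : 'I_n) : 0 < r ->
  continuous f -> continuous k ->
  (forall x, is_derive x (delta_mx 0 i) f (k x)) ->
  (forall x, ~ ceball y r x -> f x = 0) ->
  (forall x, ~ ceball y r x -> k x = 0) ->
  (\int[mu]_(x in [set: borelRn R n]) (k x)%:E = 0)%E.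
Proof.
move=> r0 cf ck df f0 k0; pose e : 'rV[R]_n := delta_mx 0 i.
have [C C0 kC] := bounded_of_support ck k0.
pose t (m : nat) : R := r / m.+1%:R.
have t0 m : 0 < t m by rewrite divr_gt0.
have tr m : t m <= r by rewrite ler_pdivrMr// ler_peMr ?ler1n// ltW.
pose D m (x : 'rV[R]_n) := (t m)^-1 * (f (x + t m *: e) - f x).
have cD m : continuous (D m).
  move=> x; apply: (@continuous_mulR _ _ (fun=> (t m)^-1)
    (fun x : 'rV[R]_n => f (x + t m *: e) - f x) x); first exact: cst_continuous.
  apply: (@continuous_addR _ _ (fun x : 'rV[R]_n => f (x + t m *: e)) (fun x => - f x) x).
    exact: continuous_translate.
  by apply: continuousN; exact: cf.
have DC m x : `|D m x| <= C.
  have cont s : {for s, continuous (fun s : R => f (s *: e + x))}.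
    exact: (is_derive_continuous (fun s => is_derive_along x s df)).
  have [c _] := @MVT_segment R (fun s => f (s *: e + x))
    (fun s => k (s *: e + x)) 0 (t m) (ltW (t0 m))
    (fun s _ => is_derive_along x s df)
    (continuous_subspaceT cont).
  rewrite scale0r add0r subr0 => H; rewrite /D (addrC x) H.
  by rewrite mulrCA mulVf ?mulr1// gt_eqF.
have e1 : enorm e = 1.
  have := @sqdist_line R n 0 0 i 1; rewrite scale1r addr0 /sqdist subr0 !mxE.
  rewrite -/e /enorm => ->.
  rewrite (_ : dotp _ _ = 0); last first.
    by rewrite /dotp big1// => j _; rewrite subrr mxE mul0r.
  by rewrite subrr mulr0 mul0r !add0r expr1n sqrtr1.
have D0 m x : ~ ceball y (2 * r) x -> D m x = 0.
  move=> xK; rewrite /D (f0 x); last first.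
    by move=> H; apply: xK; move: H; rewrite /ceball /=; lra.
  rewrite f0 ?subrr ?mulr0// => H; apply: xK.
  have -> : x = (x + t m *: e) - t m *: e by rewrite addrK.
  rewrite /ceball /= addrAC (le_trans (enorm_triangle _ _))//.
  rewrite -scaleNr enormZ e1 normrN gtr0_norm// mulr1.
  by move: H (tr m); rewrite /ceball /=; lra.
have iD m : (\int[mu]_(x in [set: borelRn R n]) (D m x)%:E = 0)%E.
  have if1 := integrable_of_support cf f0.
  have if2 : mu.-integrable [set: borelRn R n]
      (EFin \o (fun x : 'rV[R]_n => f (x + t m *: e))).
    exact: (@integrable_of_support (y - t m *: e) r _
      (continuous_translate (h := t m *: e) cf) (support_translate f0)).
  transitivity (((t m)^-1)%:E * \int[mu]_(x in [set: borelRn R n])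
      ((f (x + t m *: e)%R)%:E - (f x)%:E))%E.
    by rewrite -integralZl//; exact: (integrableB measurableT if2 if1).
  rewrite (integralB measurableT if2 if1).
  rewrite (integral_translation (t m *: e) cf f0) subee ?mule0//.
  exact: (integrable_fin_num measurableT if1).
have iC : mu.-integrable [set: borelRn R n]
    ((EFin \o cst C) \_ (ceball y (2 * r))).
  have mK := measurable_ceball y (2 * r).
  apply/(integrable_mkcond _ mK); apply: measurable_bounded_integrable.
  - exact: measurable_ceball.
  - exact: mu_ceball_fin.
  - exact: measurable_cst.
  - exists C; split; first exact: num_real.
    by move=> M CM x _; rewrite /= ger0_norm// ltW.
have := @dominated_convergence _ _ R mu setT measurableT
  (fun m x => (D m x)%:E) (fun x => (k x)%:E) _ _ _ _ iC _.
case.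
- by move=> m; apply/measurable_EFinP; exact: continuous_borel.
- by apply/measurable_EFinP; exact: continuous_borel.
- apply: aeW => x _; apply: cvg_EFin; first exact: nearW.
  have [dx Dx] := df x.
  have := dx; rewrite /derivable => /cvg_ex[/= l Hl].
  have lk : l = k x by rewrite -Dx /derive; apply/esym/cvg_lim.
  move: Hl; rewrite lk => /cvgr_dnbhsP /(_ t).
  have tc : t m @[m --> \oo] --> 0.
    rewrite -[X in _ --> X](mulr0 r); apply: cvgMl_tmp; exact: cvg_harmonic.
  move=> /(_ (conj (fun m => lt0r_neq0 (t0 m)) tc)).
  by rewrite /D /=; under eq_fun do rewrite (addrC _ x).
- apply: aeW => x m _; rewrite patchE; case: ifPn => /=.
    by move=> _; rewrite lee_fin.
  by rewrite notin_setE => /D0 ->; rewrite normr0.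
move=> _ _; under eq_fun do rewrite iD.
by move=> H; have /cvg_lim <- := H => //; rewrite lim_cst.
Qed.

End integration.

(** * Weak derivatives of continuously differentiable functions *)

(** The square of the positive part is the simplest profile of a compactly
    supported function of class C^1. *)
Lemma is_derive_sqr_max (R : realType) (s : R) :
  is_derive s 1 (fun s : R => Num.max s 0 ^+ 2) (2 * Num.max s 0).
Proof.
have [s0|s0|->] := ltgtP s 0.
- apply: (@near_eq_is_derive _ _ _ (cst 0)).
    near=> z; rewrite /= max_r ?expr0n//.
    by apply: ltW; near: z; apply: lt_nbhsl.
  by rewrite mulr0; exact: is_derive_cst.
- apply: (@near_eq_is_derive _ _ _ (fun z : R => z ^+ 2)).
    near=> z; rewrite max_l//.
    by apply: ltW; near: z; apply: lt_nbhsr.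
  by apply: is_derive_eq; rewrite /GRing.scale /=; ring.
- rewrite ?maxxx mulr0; apply/is_derive1_caratheodory.
  exists (fun z => Num.max z 0); split; last by rewrite maxxx.
    by move=> z; have [?|?] := leP z 0; rewrite maxxx; ring.
  apply: (@continuous_max _ _ id (cst 0)); [exact: cvg_id|exact: cst_continuous].
Unshelve. all: by end_near. Qed.

Lemma near_cst_continuous (R : realType) (T : topologicalType) (f : T -> R)
    (x : T) (c : R) :
  (\forall z \near x, f z = c) -> {for x, continuous f}.
Proof.
move=> fc; have fx : f x = c by exact: nbhs_singleton fc.
apply/cvgrPdist_lt => e e0; near=> z.
by rewrite fx (_ : f z = c) ?subrr ?normr0//; near: z.
Unshelve. all: by end_near. Qed.

Section weak_derivative.
Variables (R : realType) (n : nat).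
Variable mu : {measure set (borelRn R n) -> \bar R}.
Hypothesis lebmu : is_lebesgue mu.
Implicit Types (Omega : set 'rV[R]_n) (f k : 'rV[R]_n -> R).

Lemma integral_support Omega (x0 : 'rV[R]_n) (r : R) f :
  ceball x0 r `<=` Omega ->
  (forall x, Omega x -> ~ ceball x0 r x -> f x = 0) ->
  (\int[mu]_(x in (Omega : set (borelRn R n))) (f x)%:E =
   \int[mu]_(x in (ceball x0 r : set (borelRn R n))) (f x)%:E)%E.
Proof.
move=> KO f0; rewrite integral_mkcond [RHS]integral_mkcond.
apply: eq_integral => x _; rewrite !patchE.
have [xK|xK] := boolP (x \in ceball x0 r).
  by rewrite ifT// inE; apply: KO; rewrite inE in xK.
case: ifPn => // xO; rewrite f0//; first by rewrite inE in xO.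
by rewrite notin_setE in xK.
Qed.

Lemma integrable_continuous_ceball Omega (x0 : 'rV[R]_n) (r : R) f :
  open Omega -> (forall x, Omega x -> {for x, continuous f}) ->
  ceball x0 r `<=` Omega ->
  mu.-integrable (ceball x0 r : set (borelRn R n)) (EFin \o f).
Proof.
move=> oO cf KO; apply: measurable_bounded_integrable.
- exact: measurable_ceball.
- exact: mu_ceball_fin.
- apply: (@measurable_funS _ _ _ _ (Omega : set (borelRn R n))) => //.
    exact: open_borel.
  exact: continuous_on_borel.
- have cK := @compact_closed_eball R n x0 r.
  have cfK : {within ceball x0 r, continuous f}.
    by apply: continuous_in_subspaceT => x; rewrite inE => /KO; exact: cf.
  have /compact_bounded[M [_ HM]] := continuous_compact cfK cK.
  by exists M; split; [exact: num_real|move=> N MN x xK; apply: HM => //; exists x].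
Qed.

Lemma mu_ceball_gt0 (x0 : 'rV[R]_n) (r : R) : 0 < r ->
  (0 < mu (ceball x0 r))%E.
Proof.
move=> r0; pose s : R := r / n.+1%:R.
have s0 : 0 < s by rewrite divr_gt0.
pose a : 'rV[R]_n := \row_i (x0 0 i - s); pose b : 'rV[R]_n := \row_i (x0 0 i + s).
have box0 : (0 < mu (box a b))%E.
  rewrite lebmu; last by move=> i; rewrite !mxE; lra.
  by rewrite lte_fin; apply: prodr_gt0 => i _; rewrite !mxE; lra.
apply: lt_le_trans box0 _; apply: le_measure; rewrite ?inE.
- exact: measurable_box.
- exact: measurable_ceball.
move=> x xab; rewrite /ceball /= -(ler_pXn2r (n := 2)) ?nnegrE ?enorm_ge0 ?(ltW r0)//.
rewrite -sqdist_enorm sqdistE.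
apply: (@le_trans _ _ (\sum_(i < n) s ^+ 2)).
  apply: ler_sum => i _; have := xab i; rewrite !mxE => /andP[? ?]; nra.
rewrite sumr_const card_ord -mulr_natl.
rewrite /s expr_div_n mulrA ler_pdivrMr ?exprn_gt0// mulrC ler_wpM2l ?sqr_ge0//.
rewrite -natrX ler_nat; apply: leq_trans (leqnSn n) _.
by rewrite -{1}(expn1 n.+1) leq_pexp2l.
Qed.

Lemma continuous_extension0 Omega (x0 : 'rV[R]_n) (r : R) f :
  open Omega -> (forall x, Omega x -> {for x, continuous f}) ->
  ceball x0 r `<=` Omega -> (forall x, ~ ceball x0 r x -> f x = 0) ->
  continuous f.
Proof.
move=> oO cf KO f0 x; have [Ox|Ox] := pselect (Omega x); first exact: cf.
apply: (@near_cst_continuous _ _ f x 0).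
have : nbhs x (~` ceball x0 r).
  apply: open_nbhs_nbhs; split; first by apply: closed_openC; exact: closed_ceball.
  by move=> /KO.
by apply: filterS => z zK; rewrite f0.
Qed.

(** A classical derivative larger than M on a ball cannot agree with a weak
    derivative bounded by M. Testing with a bump function on that ball and
    integrating by parts gives the same integral for both, while the integrands
    differ by at least a positive multiple of the bump. The sign sg of the
    derivative is built into the bump, so that one argument covers both
    signs. *)
Lemma partial_le_of_weak Omega (p g : 'rV[R]_n -> R) (i : 'I_n) (M : R) :
  open Omega -> Ck 1 Omega p -> 0 <= M ->
  measurable_fun (Omega : set (borelRn R n)) (g : borelRn R n -> R) ->
  {ae mu, forall x : borelRn R n, Omega x -> `|g x| <= M} ->
  weak_partial mu Omega i p g ->
  forall x0, Omega x0 -> `|partial i p x0| <= M.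
Proof.
move=> oO Cp M0 mg gM wp x0 Ox0; rewrite leNgt; apply/negP => Mq.
have [cp /(_ i)[dp [cq _]]] := Cp.
set q := partial i p in cq Mq *.
pose sg : R := Num.sg (q x0).
have qx0 : q x0 != 0.
  by apply: contraTneq Mq => ->; rewrite normr0 -leNgt.
have sgq : sg * q x0 = `|q x0| by rewrite normrEsg.
have sg1 : `|sg| = 1 by rewrite normr_sg qx0.
pose m : R := (M + `|q x0|) / 2.
have [d d0 dP] : exists2 d : R, 0 < d &
    forall x, ceball x0 d x -> Omega x /\ m < sg * q x.
  have cs : {for x0, continuous (fun x => sg * q x)}.
    by apply: continuous_mulR; [exact: cst_continuous|exact: cq].
  have : \forall x \near x0, Omega x /\ m < sg * q x.
    apply: filterI; first exact: open_nbhs_nbhs.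
    by apply: (cvgr_gt _ cs); rewrite sgq /m; lra.
  move=> /nbhs_ballP[e e0 eP]; exists (e / 2); first by rewrite divr_gt0.
  move=> x xd; apply: eP; rewrite -ball_normE /= distrC.
  apply: (le_lt_trans (norm_le_enorm _)); apply: (le_lt_trans xd).
  by move: e0; rewrite /= => ?; lra.
have KO : ceball x0 d `<=` Omega by move=> x /dP[].
pose F (t : R) : R := sg * Num.max (d ^+ 2 - t) 0 ^+ 2.
pose dF (t : R) : R := - sg * (2 * Num.max (d ^+ 2 - t) 0).
have dFE (t : R) : is_derive t 1 F (dF t).
  have d1 : is_derive t 1 (fun t => d ^+ 2 - t) (-1 : R).
    by apply: is_derive_eq; rewrite /GRing.scale /=; ring.
  have d2 : is_derive t 1 (fun t : R => Num.max (d ^+ 2 - t) 0 ^+ 2)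
      (2 * Num.max (d ^+ 2 - t) 0 * -1).
    exact: (@is_derive_compR _ _ (fun s => Num.max s 0 ^+ 2)
      (fun t : R => d ^+ 2 - t) t 1 _ _ (is_derive_sqr_max (d ^+ 2 - t)) d1).
  by apply: is_derive_eq; rewrite /GRing.scale /= /dF; ring.
have cdF : continuous dF.
  move=> t; apply: (@continuous_mulR _ _ (fun=> - sg)
    (fun t => 2 * Num.max (d ^+ 2 - t) 0) t); first exact: cst_continuous.
  apply: continuous_mulR; first exact: cst_continuous.
  apply: (@continuous_max _ _ (fun t => d ^+ 2 - t) (cst 0));
    last exact: cst_continuous.
  by apply: continuousB; [exact: cst_continuous|exact: cvg_id].
pose phi := radial x0 F.
pose dphi := radial_grad x0 dF i.
have cphi : continuous phi.
  by apply: continuous_radial; exact: is_derive_continuous dFE.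
have cdphi : continuous dphi by exact: continuous_radial_grad.
have dphiE x : is_derive x (delta_mx 0 i) phi (dphi x) by exact: is_derive_radial.
have maxK x : ~ ceball x0 d x -> Num.max (d ^+ 2 - sqdist x0 x) 0 = 0.
  move=> /negP; rewrite /ceball /= -ltNge => h; apply: max_r.
  by rewrite subr_le0 sqdist_enorm ler_pXn2r ?nnegrE ?enorm_ge0 ?ltW.
have phi0 x : ~ ceball x0 d x -> phi x = 0.
  by move=> /maxK h; rewrite /phi /radial /F h expr0n mulr0.
have dphi0 x : ~ ceball x0 d x -> dphi x = 0.
  by move=> /maxK h; rewrite /dphi /radial_grad /dF h !mulr0 mul0r.
have testphi : C1c Omega phi.
  split.
    apply: (@Ck1_of_partials _ _ _ _ (fun j => radial_grad x0 dF j)) => // j.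
      by move=> x; exact: is_derive_radial.
    exact: continuous_radial_grad.
  exists (ceball x0 d); split=> //; first exact: compact_closed_eball.
  by move=> x _; exact: phi0.
(* The product p phi, extended by 0, is of class C^1 on the whole space. *)
have ibp : (\int[mu]_(x in (ceball x0 d : set (borelRn R n)))
    (q x * phi x + p x * dphi x)%:E = 0)%E.
  pose k x := q x * phi x + p x * dphi x.
  have k0 x : ~ ceball x0 d x -> k x = 0.
    by move=> xK; rewrite /k phi0// dphi0// !mulr0 addr0.
  have f0 x : ~ ceball x0 d x -> p x * phi x = 0.
    by move=> xK; rewrite phi0// mulr0.
  rewrite -(@integral_support setT x0 d k)//; last by move=> x _; exact: k0.
  apply: (@integral_partial_eq0 R n mu lebmu x0 d (fun x => p x * phi x) k i d0) => //.
  - apply: (continuous_extension0 oO _ KO f0) => x Ox.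
    by apply: continuous_mulR; [exact: cp|exact: cphi].
  - apply: (continuous_extension0 oO _ KO k0) => x Ox.
    by apply: continuous_addR; apply: continuous_mulR;
      [exact: cq|exact: cphi|exact: cp|exact: cdphi].
  - move=> x; have [Ox|Ox] := pselect (Omega x).
      apply: is_derive_mulR => //; apply: DeriveDef => //; exact: dp.
    apply: (@near_eq_is_derive _ _ _ (cst 0)).
      have : nbhs x (~` ceball x0 d).
        apply: open_nbhs_nbhs; split; first by apply: closed_openC; exact: closed_ceball.
        by move=> /KO.
      by apply: filterS => z zK; rewrite /= f0.
    by rewrite -/(k x) k0; [exact: is_derive_cst|move=> /KO].
pose K : set (borelRn R n) := ceball x0 d.
have mK : measurable K by exact: measurable_ceball.
(* g is truncated on a null set to make the bound hold everywhere. *)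
pose g' x := Num.max (- M) (Num.min (g x) M).
have g'M x : `|g' x| <= M.
  by rewrite ler_norml /g' le_max lexx /= ge_max ge_min lexx orbT andbT; lra.
have [C C0 phiC] := bounded_of_support cphi phi0.
have iq : mu.-integrable K (EFin \o (fun x => q x * phi x)).
  apply: (integrable_continuous_ceball oO _ KO) => x Ox.
  by apply: continuous_mulR; [exact: cq|exact: cphi].
have ip : mu.-integrable K (EFin \o (fun x => p x * dphi x)).
  apply: (integrable_continuous_ceball oO _ KO) => x Ox.
  by apply: continuous_mulR; [exact: cp|exact: cdphi].
have mphi : measurable_fun K (phi : borelRn R n -> R).
  by apply: measurable_funTS; exact: continuous_borel.
have mgK : measurable_fun K (g : borelRn R n -> R).
  by apply: (measurable_funS (open_borel oO)).
have mg' : measurable_fun K (g' : borelRn R n -> R).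
  apply: measurable_maxr; first exact: measurable_cst.
  by apply: measurable_minr => //; exact: measurable_cst.
have ig : mu.-integrable K (EFin \o (fun x => g' x * phi x)).
  apply: measurable_bounded_integrable => //.
  - exact: mu_ceball_fin.
  - exact: measurable_funM.
  - exists (M * C); split; first exact: num_real.
    move=> N MN x _; apply: le_trans (ltW MN).
    by rewrite normrM ler_pM.
have gg' : (\int[mu]_(x in K) (g x * phi x)%:E =
            \int[mu]_(x in K) (g' x * phi x)%:E)%E.
  apply: ae_eq_integral => //.
  - by apply/measurable_EFinP; exact: measurable_funM.
  - by apply/measurable_EFinP; exact: measurable_funM.
  - apply: filterS gM => x gM Kx; congr (_%:E); congr (_ * _).
    have := gM (KO _ Kx); rewrite ler_norml /g' => /andP[gl gr].
    by rewrite min_l// max_r.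
have weak : (\int[mu]_(x in K) (p x * dphi x)%:E =
    - \int[mu]_(x in K) (g' x * phi x)%:E)%E.
  have := wp phi testphi.
  have -> : partial i phi = dphi by apply/funext => x; exact: partial_is_derive.
  rewrite (@integral_support Omega x0 d)//; last first.
    by move=> x _ /dphi0 ->; rewrite mulr0.
  rewrite (@integral_support Omega x0 d (fun x => g x * phi x))//; last first.
    by move=> x _ /phi0 ->; rewrite mulr0.
  by move=> ->; rewrite -gg'.
have qg : (\int[mu]_(x in K) (q x * phi x)%:E =
    \int[mu]_(x in K) (g' x * phi x)%:E)%E.
  move: ibp; under eq_integral do rewrite EFinD.
  rewrite (integralD mK iq ip) weak => /eqP.
  rewrite sube_eq ?add0e; first by move=> /eqP.
    exact: (integrable_fin_num mK iq).
  by rewrite fin_num_adde_defl// (integrable_fin_num mK ig).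
have em : 0 < m - M by rewrite /m; lra.
have iphi : mu.-integrable K (EFin \o (fun x => (m - M) * `|phi x|)).
  apply: (integrable_continuous_ceball oO _ KO) => x Ox.
  apply: continuous_mulR; first exact: cst_continuous.
  apply: (@continuous_comp _ _ _ phi Num.norm); first exact: cphi.
  exact: norm_continuous.
have phisg x : phi x = sg * `|phi x|.
  rewrite /phi /radial /F normrM sg1 mul1r ger0_norm//.
  by rewrite exprn_ge0// le_max lexx orbT.
have le0 : (\int[mu]_(x in K) ((m - M) * `|phi x|)%:E <= 0)%E.
  have : (\int[mu]_(x in K) ((g' x * phi x)%:E + ((m - M) * `|phi x|)%:E) <=
      \int[mu]_(x in K) (q x * phi x)%:E)%E.
    apply: le_integral => //; first exact: integrableD.
    move=> x; rewrite inE => /dP[_ mq]; rewrite -EFinD lee_fin.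
    have h1 : g' x * phi x <= M * `|phi x|.
      by rewrite (le_trans (ler_norm _))// normrM ler_wpM2r.
    have h2 : m * `|phi x| <= q x * phi x.
      by rewrite [in leRHS]phisg mulrA (mulrC (q x)) ler_wpM2r// ltW.
    by move: h1 h2; rewrite mulrBl; lra.
  rewrite (integralD mK ig iphi) qg.
  rewrite -[X in (_ <= X)%E]adde0 leeD2lE//.
  exact: (integrable_fin_num mK ig).
have d20 : 0 < d / 2 by rewrite divr_gt0.
pose B : set (borelRn R n) := ceball x0 (d / 2).
pose c : R := (m - M) * (d ^+ 2 - (d / 2) ^+ 2) ^+ 2.
have d2d : d / 2 <= d by rewrite ler_pdivrMr// ler_pMr// ler1n.
have dd : 0 < d ^+ 2 - (d / 2) ^+ 2.
  by rewrite subr_gt0 ltr_pXn2r ?nnegrE ?ltW// ltr_pdivrMr// ltr_pMr// ltr1n.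
have c0 : 0 < c by rewrite mulr_gt0// exprn_gt0.
have BK : B `<=` K by move=> x /le_trans; apply.
have mB : measurable B by exact: measurable_ceball.
have : (0 < \int[mu]_(x in K) ((m - M) * `|phi x|)%:E)%E.
  apply: (@lt_le_trans _ _ (c%:E * mu B)%E).
    by rewrite mule_gt0// mu_ceball_gt0.
  rewrite -(integral_cst mu mB).
  apply: (@le_trans _ _ (\int[mu]_(x in B) ((m - M) * `|phi x|)%:E)%E).
    apply: ge0_le_integral => //.
    - by move=> x _; rewrite lee_fin ltW.
    - apply: (measurable_funS mK); last by have /integrableP[] := iphi.
      exact: BK.
    - move=> x xB; rewrite lee_fin ler_pM2l// /phi /radial /F normrM sg1 mul1r.
      rewrite (le_trans _ (ler_norm _))// ler_pXn2r ?nnegrE ?(ltW dd)//.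
        by rewrite le_max lerB// sqdist_enorm ler_pXn2r ?nnegrE ?enorm_ge0 ?(ltW d20).
      by rewrite le_max lexx orbT.
  apply: ge0_subset_integral => //.
  - by have /integrableP[] := iphi.
  - by move=> x _; rewrite lee_fin mulr_ge0// ltW.
by rewrite ltNge le0.
Qed.

End weak_derivative.

(** That the bound does not degenerate towards the boundary of Omega makes the
    final constant uniform over all balls. *)
Lemma partial_bounded_W1infty (R : realType) (n : nat) (Omega : set 'rV[R]_n)
    (p : 'rV[R]_n -> R) :
  open Omega -> Ck 1 Omega p -> W1infty Omega p ->
  exists2 M : R, 0 <= M & forall i x, Omega x -> `|partial i p x| <= M.
Proof.
move=> oO Cp [mu [lebmu _ Wp]].
have H (i : 'I_n) : exists M : R, 0 <= M /\
    forall x, Omega x -> `|partial i p x| <= M.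
  have [g [mg [M gM]] wg] := Wp i.
  exists (Num.max M 0); split; first by rewrite le_max lexx orbT.
  apply: (partial_le_of_weak lebmu oO Cp _ mg _ wg).
    by rewrite le_max lexx orbT.
  by apply: filterS gM => x gM Ox; rewrite le_max gM.
pose M i := projT1 (cid (H i)).
have MP i := projT2 (cid (H i)).
exists (\sum_i M i); first by apply: sumr_ge0 => i _; exact: (MP i).1.
move=> i x Ox; apply: le_trans ((MP i).2 x Ox) _.
rewrite (bigD1 i) //= lerDl; apply: sumr_ge0 => j _; exact: (MP j).1.
Qed.

(** * The Harnack inequality *)

Lemma partial_ln_le (R : realType) (n : nat) (Omega : set 'rV[R]_n)
    (p : 'rV[R]_n -> R) (i : 'I_n) (x : 'rV[R]_n) :
  Ck 1 Omega p -> Omega x -> 1 < p x ->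
  `|partial i (fun z => ln (p z)) x| <= `|partial i p x|.
Proof.
move=> [_ /(_ i)[dp _]] Ox px; have p0 : 0 < p x by exact: lt_trans px.
have dpx : is_derive x (delta_mx 0 i) p (partial i p x).
  by apply: DeriveDef => //; exact: dp.
rewrite (partial_is_derive (is_derive_compR (is_derive1_ln p0) dpx)).
rewrite normrM ger0_norm ?invr_ge0 ?(ltW p0)// -[X in _ <= X]mul1r.
by rewrite ler_wpM2r// invf_le1// ltW.
Qed.

Lemma lower_semicontinuous_near (R : realType) (T : topologicalType)
    (A : set T) (f : T -> \bar R) (x : T) (a : R) :
  lower_semicontinuous (f : subspace A -> \bar R) -> A x -> (a%:E < f x)%E ->
  \forall y \near x, A y -> (a%:E < f y)%E.
Proof.
move=> lf Ax /(lf x a)[V nV VA].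
have {}nV : within A (nbhs x) V by rewrite nbhs_subspace_in.
exact: filterS VA nV.
Qed.

Lemma semicontinuous_continuous (R : realType) (T : topologicalType)
    (A : set T) (u : T -> \bar R) (x : T) :
  open A -> (forall y, A y -> u y \is a fin_num) ->
  lower_semicontinuous (u : subspace A -> \bar R) ->
  lower_semicontinuous ((fun y => - u y)%E : subspace A -> \bar R) ->
  A x -> {for x, continuous (fun y => fine (u y))}.
Proof.
move=> oA fu lu uu Ax; apply/cvgrPdist_lt => e e0.
have ux y : A y -> u y = (fine (u y))%:E by move=> Ay; rewrite fineK ?fu.
have h1 : \forall y \near x, A y -> ((fine (u x) - e)%:E < u y)%E.
  by apply: lower_semicontinuous_near => //; rewrite [ltRHS]ux// lte_fin; lra.
have h2 : \forall y \near x, A y -> ((- fine (u x) - e)%:E < - u y)%E.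
  apply: (@lower_semicontinuous_near _ _ A (fun y => - u y)%E) => //.
  by rewrite [in ltRHS]ux// lte_fin; lra.
near=> y.
have Ay : A y by near: y; apply: open_nbhs_nbhs.
have : ((fine (u x) - e)%:E < u y)%E by apply: (near h1 y).
have : ((- fine (u x) - e)%:E < - u y)%E by apply: (near h2 y).
rewrite (ux y)// !lte_fin /= ltr_norml => ? ?; apply/andP; split; lra.
Unshelve. all: by end_near. Qed.

Lemma bounded_eball_radius (R : realType) (n : nat) (Omega : set 'rV[R]_n) :
  (0 < n)%N -> bounded_set Omega ->
  exists2 D : R, 0 <= D &
    forall (x0 : 'rV[R]_n) (r : R), 0 < r -> eball x0 (2 * r) `<=` Omega -> r <= D.
Proof.
move=> n0 [B [_ HB]].
pose b := `|B| + 1.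
have bO x : Omega x -> `|x| <= b.
  by move=> Ox; apply: (HB b) => //; rewrite /b (le_lt_trans (ler_norm B))// ltrDl.
exists (2 * b); first by rewrite mulr_ge0// addr_ge0.
move=> x0 r r0 ballO.
pose i := Ordinal n0; pose e : 'rV[R]_n := r *: delta_mx 0 i.
have Ox0 : Omega x0.
  apply: ballO; rewrite /eball /= (_ : enorm _ = 0) ?mulr_gt0//.
  by apply/eqP; rewrite enorm_sub_eq0.
have Oe : Omega (e + x0).
  apply: ballO; rewrite /eball /= -(ltr_pXn2r (n := 2)) ?nnegrE ?enorm_ge0 ?mulr_ge0 ?ltW//.
  rewrite -sqdist_enorm sqdist_line (_ : sqdist x0 x0 = 0); last first.
    by apply/eqP; rewrite sqdist_eq0.
  by nra.
have := coord_le_norm (e + x0) i; have := coord_le_norm x0 i.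
have := bO _ Ox0; have := bO _ Oe.
rewrite !mxE !eqxx mulr1 => h1 h2 h3 h4.
have := le_trans h3 h2; have := le_trans h4 h1.
by rewrite !ler_norml => /andP[? ?] /andP[? ?]; lra.
Qed.

Theorem theorem1p4 (R : realType) (n : nat) (Omega : set 'rV[R]_n)
    (p : 'rV[R]_n -> R) :
  (0 < n)%N ->
  domain Omega -> bounded_set Omega ->
  Ck 1 Omega p -> W1infty Omega p -> (forall x, Omega x -> 1 < p x) ->
  exists C : R -> R,
    forall u : 'rV[R]_n -> \bar R,
      viscosity_solution Omega p u ->
      (forall x, Omega x -> (0 <= u x)%E) ->
      forall (x0 : 'rV[R]_n) (r : R),
        0 < r -> eball x0 (2 * r) `<=` Omega ->
        (ereal_sup (u @` eball x0 (2 * r)) < +oo)%E ->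
        (ereal_sup (u @` eball x0 r) <=
         (C (fine (ereal_sup (u @` eball x0 (2 * r)))))%:E *
         (ereal_inf (u @` eball x0 r) + r%:E))%E.
Proof.
move=> n0 [oO _ _] bO Cp Wp p1.
have [L L0 pL] := partial_bounded_W1infty oO Cp Wp.
have [D D0 rD] := bounded_eball_radius n0 bO.
pose c := Num.ceil (n%:R * L * D * 4); pose N := `|c|%N.+1.
have K0 : 0 <= n%:R * L by rewrite mulr_ge0.
have ND : n%:R * L * D <= N%:R / 4.
  rewrite ler_pdivlMr//; apply: (le_trans (Num.Theory.ceil_ge _)); rewrite -/c.
  by rewrite /N -(natr1 `|c|%N) natr_absz ler_wpDr// ler_int ler_norm.
exists (fun M => (2 * expR (D + 2 * (n%:R * L) * M)) ^+ (4 * N)).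
move=> u [superu subu] u0 x0 r r0 ballO.
set S := ereal_sup _ => Soo.
have ufin x : Omega x -> u x \is a fin_num.
  move=> Ox; rewrite ge0_fin_numE; [by case: subu => _ /(_ _ Ox)|exact: u0].
have sub12 : eball x0 r `<=` eball x0 (2 * r).
  by move=> z; rewrite /eball /=; lra.
have x0r : eball x0 r x0.
  rewrite /eball /= (_ : enorm _ = 0)//.
  by apply/eqP; rewrite enorm_sub_eq0.
have uS z : eball x0 (2 * r) z -> (u z <= S)%E.
  by move=> zr; apply: ereal_sup_ubound; exists z.
have S0 : (0 <= S)%E by apply: le_trans (uS x0 (sub12 _ x0r)); exact/u0/ballO/sub12.
have Sfin : S \is a fin_num by rewrite ge0_fin_numE.
set C := _ ^+ _; have C0 : 0 < C by rewrite exprn_gt0// mulr_gt0// expR_gt0.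
have key y x : eball x0 r y -> eball x0 r x ->
    (u y <= C%:E * (u x + r%:E))%E.
  move=> yr xr.
  have Oy : Omega y by exact/ballO/sub12.
  have Ox : Omega x by exact/ballO/sub12.
  rewrite -(fineK (ufin _ Oy)) -(fineK (ufin _ Ox)) -EFinD -EFinM lee_fin.
  apply: (@Harnack_chain R n Omega p u (fun z => fine (u z)) L superu _ _ _ L0 _
    x0 y x r (fine S) D N) => //.
  - by move=> z Oz; rewrite fineK// ufin.
  - by move=> z Oz; rewrite fine_ge0// u0.
  - move=> z Oz; apply: (semicontinuous_continuous oO) => //.
      by case: superu.
    by case: subu.
  - move=> i z Oz; apply: le_trans (pL i z Oz).
    exact: (partial_ln_le i Cp Oz (p1 z Oz)).
  - exact: rD ballO.
  - by move=> z zr; rewrite fine_le// ?uS// ufin//; exact: ballO.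
apply/ereal_supP => _ [y yr <-].
rewrite -lee_pdivrMl// -leeBlDr//.
apply/ereal_infP => _ [x xr <-].
by rewrite leeBlDr// lee_pdivrMl// key.
Qed.
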